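(* The standard truth predicate for the standard model $\mathbb{N}$ is definable by a formula $T(x)$ in the full extension-potentialist language of arithmetic: for every $M\models\mathrm{PA}^+$ and $x\in M$, $M\models T(x)$ if and only if $x$ is standard and is the Gödel code of an arithmetic sentence true in $\mathbb{N}$.
   Context: Fix a consistent computably enumerable theory $\mathrm{PA}^+$ extending $\mathrm{PA}$. For $M\models\mathrm{PA}^+$, $M\models\Diamond^{\mathrm{ext}}\varphi$ iff $\varphi$ holds in some extension $N\supseteq M$ with $N\models\mathrm{PA}^+$, and $\Box^{\mathrm{ext}}$ is dual. The full extension-potentialist language of arithmetic is the closure of the language $\{+,\cdot,0,1,<\}$ under Boolean connectives, number quantifiers and the operators $\Diamond^{\mathrm{ext}},\Box^{\mathrm{ext}}$, which may appear under quantifiers; it is evaluated in models of $\mathrm{PA}^+$ with parameters carried into extensions. *)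

(* Defs.v *)
From Stdlib Require Import Arith Cantor.

Set Implicit Arguments.

(** * First-order arithmetic, with de Bruijn indices *)

Inductive term : Type :=
| Var  : nat -> term
| Zero : term
| One  : term
| Add  : term -> term -> term
| Mul  : term -> term -> term.

Inductive form : Type :=
| Eq  : term -> term -> form
| Lt  : term -> term -> form
| Bot : form
| Imp : form -> form -> form
| All : form -> form.

Definition Neg (p : form) : form := Imp p Bot.
Definition And (p q : form) : form := Neg (Imp p (Neg q)).
Definition Iff (p q : form) : form := And (Imp p q) (Imp q p).
Definition Ex (p : form) : form := Neg (All (Neg p)).

Definition scons {X : Type} (x : X) (s : nat -> X) : nat -> X :=
  fun n => match n with 0 => x | S m => s m end.

Fixpoint tsubst (s : nat -> term) (t : term) : term :=
  match t with
  | Var n   => s n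
  | Zero    => Zero
  | One     => One
  | Add a b => Add (tsubst s a) (tsubst s b)
  | Mul a b => Mul (tsubst s a) (tsubst s b)
  end.

Definition shift : nat -> term := fun n => Var (S n).

Definition up (s : nat -> term) : nat -> term :=
  scons (Var 0) (fun n => tsubst shift (s n)).

Fixpoint subst (s : nat -> term) (p : form) : form :=
  match p with
  | Eq a b  => Eq (tsubst s a) (tsubst s b)
  | Lt a b  => Lt (tsubst s a) (tsubst s b)
  | Bot     => Bot
  | Imp q r => Imp (subst s q) (subst s r)
  | All q   => All (subst (up s) q)
  end.

(** [tbelow k] and [below k]: every free variable has index less than [k]. *)
Fixpoint tbelow (k : nat) (t : term) : Prop :=
  match t with
  | Var n            => n < k
  | Zero | One       => True
  | Add a b | Mul a b => tbelow k a /\ tbelow k b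
  end.

Fixpoint below (k : nat) (p : form) : Prop :=
  match p with
  | Eq a b | Lt a b => tbelow k a /\ tbelow k b
  | Bot             => True
  | Imp q r         => below k q /\ below k r
  | All q           => below (S k) q
  end.

Definition sentence (p : form) : Prop := below 0 p.

Definition theory : Type := form -> Prop.

(** * Provability *)

(** A Hilbert calculus for classical first-order logic with equality.
    Unrestricted generalization is sound because theories are only ever
    taken to be sets of sentences. *)
Inductive prv (A : theory) : form -> Prop :=
| prv_ax p : A p -> prv A p
| prv_mp p q : prv A (Imp p q) -> prv A p -> prv A q
| prv_gen p : prv A p -> prv A (All p)
| prv_K p q : prv A (Imp p (Imp q p))
| prv_S p q r :
    prv A (Imp (Imp p (Imp q r)) (Imp (Imp p q) (Imp p r)))
| prv_dn p : prv A (Imp (Neg (Neg p)) p)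
| prv_inst p t : prv A (Imp (All p) (subst (scons t Var) p))
| prv_dist p q :
    prv A (Imp (All (Imp (subst shift p) q)) (Imp p (All q)))
| prv_refl t : prv A (Eq t t)
| prv_leibniz s t p :
    prv A (Imp (Eq s t)
               (Imp (subst (scons s Var) p) (subst (scons t Var) p))).

Definition consistent (A : theory) : Prop := ~ prv A Bot.

(** * Peano arithmetic *)

Fixpoint alls (n : nat) (p : form) : form :=
  match n with 0 => p | S m => All (alls m p) end.

(** Induction for [p] in the variable [Var 0]; the other free variables of [p]
    are parameters, so variable [S n] of [p] is variable [n] of [ind p]. *)
Definition ind (p : form) : form :=
  Imp (subst (scons Zero Var) p)
      (Imp (All (Imp p (subst (scons (Add (Var 0) One) shift) p)))
           (All p)).

Inductive PA : theory :=
| PA_succ_zero : PA (All (Neg (Eq (Add (Var 0) One) Zero)))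
| PA_succ_inj :
    PA (All (All (Imp (Eq (Add (Var 1) One) (Add (Var 0) One))
                      (Eq (Var 1) (Var 0)))))
| PA_add_zero : PA (All (Eq (Add (Var 0) Zero) (Var 0)))
| PA_add_succ :
    PA (All (All (Eq (Add (Var 1) (Add (Var 0) One))
                     (Add (Add (Var 1) (Var 0)) One))))
| PA_mul_zero : PA (All (Eq (Mul (Var 0) Zero) Zero))
| PA_mul_succ :
    PA (All (All (Eq (Mul (Var 1) (Add (Var 0) One))
                     (Add (Mul (Var 1) (Var 0)) (Var 1)))))
| PA_lt :
    PA (All (All (Iff (Lt (Var 1) (Var 0))
                      (Ex (Eq (Add (Var 2) (Add (Var 0) One)) (Var 1))))))
| PA_induction n p : below (S n) p -> PA (alls n (ind p)).

Definition extends_PA (A : theory) : Prop := forall p, PA p -> prv A p.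

(** * Gödel codes and computable enumerability *)

Definition cpair (x y : nat) : nat := Cantor.to_nat (x, y).
Definition cleft (n : nat) : nat := fst (Cantor.of_nat n).
Definition cright (n : nat) : nat := snd (Cantor.of_nat n).

Fixpoint tcode (t : term) : nat :=
  match t with
  | Var n   => cpair 0 n
  | Zero    => cpair 1 0
  | One     => cpair 2 0
  | Add a b => cpair 3 (cpair (tcode a) (tcode b))
  | Mul a b => cpair 4 (cpair (tcode a) (tcode b))
  end.

Fixpoint code (p : form) : nat :=
  match p with
  | Eq a b  => cpair 0 (cpair (tcode a) (tcode b))
  | Lt a b  => cpair 1 (cpair (tcode a) (tcode b))
  | Bot     => cpair 2 0
  | Imp q r => cpair 3 (cpair (code q) (code r))
  | All q   => cpair 4 (code q)
  end.

(** Unary partial recursive functions; functions of several arguments are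
    represented through the Cantor pairing. *)
Inductive prog : Type :=
| PZero  : prog
| PSucc  : prog
| PLeft  : prog
| PRight : prog
| PPair  : prog -> prog -> prog
| PComp  : prog -> prog -> prog
| PRec   : prog -> prog -> prog
| PMin   : prog -> prog.

(** [computes c a v]: on input [a] the program [c] halts with output [v]. *)
Fixpoint computes (c : prog) (a v : nat) : Prop :=
  match c with
  | PZero => v = 0
  | PSucc => v = S a
  | PLeft => v = cleft a
  | PRight => v = cright a
  | PPair f g => exists x y, computes f a x /\ computes g a y /\ v = cpair x y
  | PComp f g => exists x, computes g a x /\ computes f x v
  | PRec f g =>
      (* [h (b, 0) = f b] and [h (b, S m) = g (b, (m, h (b, m)))] *)
      let b := cleft a in
      nat_rect (fun _ => nat -> Prop)
        (computes f b)
        (fun m R w => exists u, R u /\ computes g (cpair b (cpair m u)) w)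
        (cright a) v
  | PMin f =>
      computes f (cpair a v) 0 /\
      forall m, m < v -> exists k, computes f (cpair a m) (S k)
  end.

Definition ce_set (X : nat -> Prop) : Prop :=
  exists c : prog, forall n, X n <-> exists v, computes c n v.

Definition ce_theory (A : theory) : Prop :=
  ce_set (fun n => exists p, A p /\ code p = n).

(** * Structures, models and extensions *)

Record structure : Type := Structure {
  carrier :> Type;
  s_zero : carrier;
  s_one : carrier;
  s_add : carrier -> carrier -> carrier;
  s_mul : carrier -> carrier -> carrier;
  s_lt : carrier -> carrier -> Prop
}.

Definition std : structure := Structure 0 1 Nat.add Nat.mul lt.

Fixpoint teval (M : structure) (r : nat -> M) (t : term) : M :=
  match t with
  | Var n   => r n
  | Zero    => s_zero M
  | One     => s_one M
  | Add a b => s_add M (teval M r a) (teval M r b)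
  | Mul a b => s_mul M (teval M r a) (teval M r b)
  end.

Fixpoint sat (M : structure) (r : nat -> M) (p : form) : Prop :=
  match p with
  | Eq a b  => teval M r a = teval M r b
  | Lt a b  => s_lt M (teval M r a) (teval M r b)
  | Bot     => False
  | Imp q s => sat M r q -> sat M r s
  | All q   => forall x : M, sat M (scons x r) q
  end.

Definition models (M : structure) (A : theory) : Prop :=
  forall p, A p -> forall r : nat -> M, sat M r p.

(** Extensions are taken up to isomorphism: [N] extends [M] when [M] embeds in
    [N] as a substructure, and parameters are carried along the embedding. *)
Record embedding (M N : structure) (e : M -> N) : Prop := {
  emb_inj : forall x y, e x = e y -> x = y;
  emb_zero : e (s_zero M) = s_zero N;
  emb_one : e (s_one M) = s_one N;
  emb_add : forall x y, e (s_add M x y) = s_add N (e x) (e y);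
  emb_mul : forall x y, e (s_mul M x y) = s_mul N (e x) (e y);
  emb_lt : forall x y, s_lt M x y <-> s_lt N (e x) (e y)
}.

Fixpoint value (M : structure) (n : nat) : M :=
  match n with 0 => s_zero M | S m => s_add M (value M m) (s_one M) end.

Definition true_sentence_code (n : nat) : Prop :=
  exists p, sentence p /\ (forall r : nat -> std, sat std r p) /\ code p = n.

(** * The full extension-potentialist language *)

Inductive pform : Type :=
| MEq  : term -> term -> pform
| MLt  : term -> term -> pform
| MBot : pform
| MImp : pform -> pform -> pform
| MAll : pform -> pform
| MDia : pform -> pform
| MBox : pform -> pform.

Fixpoint pbelow (k : nat) (p : pform) : Prop :=
  match p with
  | MEq a b | MLt a b => tbelow k a /\ tbelow k b
  | MBot              => True
  | MImp q s          => pbelow k q /\ pbelow k s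
  | MAll q            => pbelow (S k) q
  | MDia q | MBox q   => pbelow k q
  end.

Fixpoint psat (A : theory) (M : structure) (r : nat -> M) (p : pform) : Prop :=
  match p with
  | MEq a b  => teval M r a = teval M r b
  | MLt a b  => s_lt M (teval M r a) (teval M r b)
  | MBot     => False
  | MImp q s => psat A M r q -> psat A M r s
  | MAll q   => forall x : M, psat A M (scons x r) q
  | MDia q   => exists (N : structure) (e : M -> N),
                  models N A /\ embedding M N e /\
                  psat A N (fun n => e (r n)) q
  | MBox q   => forall (N : structure) (e : M -> N),
                  models N A -> embedding M N e ->
                  psat A N (fun n => e (r n)) q
  end.

(* Main.v *)
(** Let [d] be the code of a formula [D(y, d)] stating that some [n < y]
    witnesses an inconsistency of the theory [A], a finite part of the diagram
    of [M] about [y], and [D(y, d)] itself.  If [y] is standard, then so is [n],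
    the inconsistency is real, and [M] refutes [D(y, d)]: hence no extension
    satisfies it.  If [y] is nonstandard and no extension of [M] satisfies
    [D(y, d)], then by compactness the inconsistency really has a standard
    witness, which is below [y], so that [M] itself satisfies [D(y, d)].
    Thus [Box ~ D(y, d)] defines the standard cut.  Inconsistency is expressed
    without proofs: by compactness of Cantor space it means that every
    assignment of truth values to [n] formulas over Henkin names violates one
    of finitely many clauses, which is a bounded, hence absolute, statement.

    Every set of standard numbers is coded by a pair of elements in an
    ultrapower of [M].  So [Dia Ex] over codes, with number quantifiers
    relativized to the standard cut, is second-order quantification over sets
    of natural numbers, and truth and syntax are definable from it. *)

From Stdlib Require Import Arith Lia Cantor List Ring Setoid.
From Stdlib Require Import Classical ClassicalEpsilon FunctionalExtensionality
  PropExtensionality ProofIrrelevance.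
From mathcomp.classical Require filter.
Require Import Defs.

(** No diagonal lemma is involved: [D] receives its own code as the ordinary parameter [d], and a
    numeral is substituted for it only at the very end. The obstacle is that facts about a
    nonstandard [y] have nonstandard parameters, whereas the inconsistency must be a genuine one
    with a standard witness. Therefore a finite list of elements of [M] is packed into one beta
    sequence [a], [b], and the refutation asks only about sums, products and comparisons of entries
    at standard indices. All else in it is a bounded statement about standard numbers, with the same
    meaning in every model of PA; hence the notion of absoluteness relative to an oracle. Putting
    [D(y, d)] itself into the refuted theory is what turns the failure of [D(y, d)] in all
    extensions into an instance of [D(y, d)], as in the proof of the second incompleteness theorem.
    Henkin assignments serve twice: as the objects refuted here, and later as the set variable in
    the definition of truth, where a set describing a copy of the standard model decides all
    sentences. *)

(** * Semantics, soundness and the standard model *)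

Lemma teval_ext (M : structure) (r r' : nat -> M) t :
  (forall n, r n = r' n) -> teval M r t = teval M r' t.
Proof. intros H; induction t; simpl; congruence. Qed.

Lemma scons_ext (X : Type) (x : X) (r r' : nat -> X) :
  (forall n, r n = r' n) -> forall n, scons x r n = scons x r' n.
Proof. intros H [|n]; simpl; auto. Qed.

Lemma sat_ext (M : structure) p (r r' : nat -> M) :
  (forall n, r n = r' n) -> sat M r p <-> sat M r' p.
Proof.
  revert r r'; induction p; intros r r' H; simpl.
  1,2: rewrite !(teval_ext M r r') by exact H; reflexivity.
  - reflexivity.
  - rewrite (IHp1 r r'), (IHp2 r r'); auto; reflexivity.
  - split; intros Hp x.
    + apply (IHp (scons x r) (scons x r')); auto using scons_ext.
    + apply (IHp (scons x r) (scons x r')); auto using scons_ext.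
Qed.

Lemma teval_subst (M : structure) (r : nat -> M) s t :
  teval M r (tsubst s t) = teval M (fun n => teval M r (s n)) t.
Proof. induction t; simpl; congruence. Qed.

Lemma teval_up (M : structure) (r : nat -> M) s x n :
  teval M (scons x r) (up s n) = scons x (fun k => teval M r (s k)) n.
Proof. destruct n; simpl; auto. rewrite teval_subst. reflexivity. Qed.

Lemma sat_subst (M : structure) p : forall (r : nat -> M) s,
  sat M r (subst s p) <-> sat M (fun n => teval M r (s n)) p.
Proof.
  induction p; intros r s; simpl.
  1,2: rewrite !teval_subst; reflexivity.
  - reflexivity.
  - rewrite IHp1, IHp2; reflexivity.
  - split; intros H x; specialize (H x).
    + rewrite IHp in H. eapply sat_ext; [|exact H].
      intros n; symmetry; apply teval_up.
    + rewrite IHp. eapply sat_ext; [|exact H].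
      intros n; apply teval_up.
Qed.

Lemma tbelow_ext (M : structure) k t (r r' : nat -> M) :
  tbelow k t -> (forall n, n < k -> r n = r' n) -> teval M r t = teval M r' t.
Proof.
  induction t; simpl; intros Ht H; auto.
  - rewrite IHt1, IHt2; tauto.
  - rewrite IHt1, IHt2; tauto.
Qed.

Lemma below_ext (M : structure) p : forall k (r r' : nat -> M),
  below k p -> (forall n, n < k -> r n = r' n) -> sat M r p <-> sat M r' p.
Proof.
  induction p; intros k r r' Hp H; simpl in *.
  1,2: destruct Hp; rewrite !(tbelow_ext M k _ r r') by auto; reflexivity.
  - reflexivity.
  - rewrite (IHp1 k r r'), (IHp2 k r r') by tauto; reflexivity.
  - assert (E : forall x n, n < S k -> scons x r n = scons x r' n)
      by (intros x [|n] Hn; simpl; auto; apply H; lia).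
    split; intros Hs x; apply (IHp (S k) (scons x r) (scons x r')); auto.
Qed.

Lemma sat_sentence (M : structure) p (r r' : nat -> M) :
  sentence p -> sat M r p <-> sat M r' p.
Proof. intros H; apply (below_ext M p 0); auto; intros n Hn; lia. Qed.

Lemma sat_Neg (M : structure) (r : nat -> M) p : sat M r (Neg p) <-> ~ sat M r p.
Proof. reflexivity. Qed.

Lemma sat_And (M : structure) (r : nat -> M) p q :
  sat M r (And p q) <-> sat M r p /\ sat M r q.
Proof. simpl; tauto. Qed.

Lemma sat_Iff (M : structure) (r : nat -> M) p q :
  sat M r (Iff p q) <-> (sat M r p <-> sat M r q).
Proof. simpl; tauto. Qed.

Lemma sat_Ex (M : structure) (r : nat -> M) p :
  sat M r (Ex p) <-> exists x, sat M (scons x r) p.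
Proof.
  simpl; split.
  - intros H; apply NNPP; intros H'; apply H; intros x Hx; apply H'; eauto.
  - intros [x Hx] H; exact (H x Hx).
Qed.

Lemma prv_sound (A : theory) (M : structure) p :
  models M A -> prv A p -> forall r : nat -> M, sat M r p.
Proof.
  intros HM Hp; induction Hp; intros e; simpl in *.
  - apply HM; auto.
  - apply (IHHp1 e), IHHp2.
  - intros x; apply IHHp.
  - tauto.
  - tauto.
  - intros H; apply NNPP; exact H.
  - intros H. apply sat_subst. eapply sat_ext; [|exact (H (teval M e t))].
    intros [|n]; reflexivity.
  - intros H H1 x. apply (H x). apply sat_subst. exact H1.
  - reflexivity.
  - intros E H. apply sat_subst. apply sat_subst in H.
    eapply sat_ext; [|exact H]. intros [|n]; simpl; auto.
Qed.

Lemma models_PA (A : theory) (M : structure) :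
  extends_PA A -> models M A -> models M PA.
Proof. intros H HM p Hp; apply (prv_sound A M p HM (H p Hp)). Qed.

Lemma sat_alls (M : structure) n p : (forall r : nat -> M, sat M r (alls n p)) ->
  forall r : nat -> M, sat M r p.
Proof.
  induction n; simpl; intros H; auto.
  apply IHn. intros r. specialize (H (fun k => r (S k)) (r 0)).
  eapply sat_ext; [|exact H]. intros [|k]; reflexivity.
Qed.

Lemma sat_alls_intro (M : structure) n p : (forall r : nat -> M, sat M r p) ->
  forall r : nat -> M, sat M r (alls n p).
Proof. induction n; simpl; auto. Qed.

Lemma tbelow_mono k k' t : tbelow k t -> k <= k' -> tbelow k' t.
Proof. induction t; simpl; auto; try lia; tauto. Qed.

Lemma below_mono p : forall k k', below k p -> k <= k' -> below k' p.
Proof.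
  induction p; simpl; intros k k' H L; auto.
  1,2: destruct H; split; eapply tbelow_mono; eauto.
  - destruct H; split; eauto.
  - apply (IHp (S k)); auto; lia.
Qed.

Lemma tbelow_bound t : exists k, tbelow k t.
Proof.
  induction t; simpl.
  - exists (S n); lia.
  - exists 0; auto.
  - exists 0; auto.
  - destruct IHt1 as [a Ha], IHt2 as [b Hb]. exists (a + b).
    split; eapply tbelow_mono; eauto; lia.
  - destruct IHt1 as [a Ha], IHt2 as [b Hb]. exists (a + b).
    split; eapply tbelow_mono; eauto; lia.
Qed.

Lemma below_bound p : exists k, below k p.
Proof.
  induction p; simpl.
  1,2: destruct (tbelow_bound t) as [a Ha], (tbelow_bound t0) as [b Hb];
    exists (a + b); split; eapply tbelow_mono; eauto; lia.
  - exists 0; auto.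
  - destruct IHp1 as [a Ha], IHp2 as [b Hb]. exists (a + b).
    split; eapply below_mono; eauto; lia.
  - destruct IHp as [a Ha]. exists a. eapply below_mono; eauto.
Qed.

Lemma sat_ind (M : structure) (r : nat -> M) p :
  sat M r (ind p) <->
  (sat M (scons (s_zero M) r) p ->
   (forall x, sat M (scons x r) p -> sat M (scons (s_add M x (s_one M)) r) p) ->
   forall x, sat M (scons x r) p).
Proof.
  unfold ind; simpl.
  assert (E0 : sat M r (subst (scons Zero Var) p) <->
               sat M (scons (s_zero M) r) p).
  { rewrite sat_subst. apply sat_ext. intros [|n]; reflexivity. }
  assert (E1 : forall x, sat M (scons x r)
      (subst (scons (Add (Var 0) One) shift) p) <->
      sat M (scons (s_add M x (s_one M)) r) p).
  { intros x. rewrite sat_subst. apply sat_ext. intros [|n]; reflexivity. }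
  rewrite E0. setoid_rewrite E1. reflexivity.
Qed.

Lemma std_value n : value std n = n.
Proof. induction n; simpl in *; auto. rewrite IHn; lia. Qed.

Lemma std_PA : models std PA.
Proof.
  intros p Hp r. destruct Hp.
  - intros x; simpl; lia.
  - intros x y; simpl; lia.
  - intros x; simpl; lia.
  - intros x y; simpl; lia.
  - intros x; simpl; lia.
  - intros x y; simpl. rewrite Nat.add_comm; simpl. lia.
  - intros x y. rewrite sat_Iff, sat_Ex. simpl. split.
    + intros H. exists (y - x - 1). lia.
    + intros [z Hz]. lia.
  - apply sat_alls_intro. clear r. intros r. apply sat_ind. simpl.
    intros H0 HS x. induction x; auto.
    specialize (HS x IHx). rewrite Nat.add_comm in HS. exact HS.
Qed.

(** * Arithmetic in a model of PA *)

Section Arithmetic.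
Variable M : structure.
Hypothesis MPA : models M PA.

Notation "x ⊕ y" := (s_add M x y) (at level 50, left associativity).
Notation "x ⊗ y" := (s_mul M x y) (at level 40, left associativity).
Notation o := (s_zero M).
Notation i := (s_one M).
Notation "x ≺ y" := (s_lt M x y) (at level 70).

(** Induction over possibly nonstandard elements works only for definable properties, so each use
    supplies a formula explicitly, with its parameters in [r]. *)
Lemma pa_ind (p : form) (r : nat -> M) :
  sat M (scons o r) p ->
  (forall x, sat M (scons x r) p -> sat M (scons (x ⊕ i) r) p) ->
  forall x, sat M (scons x r) p.
Proof.
  destruct (below_bound p) as [k Hk].
  pose proof (MPA _ (PA_induction k p (below_mono p _ _ Hk (Nat.le_succ_diag_r k)))) as H.
  apply (sat_ind M r p). revert r. apply (sat_alls M k). exact H.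
Qed.

Let dummy : nat -> M := fun _ => o.

Lemma pa_succ_zero x : x ⊕ i <> o.
Proof. exact (MPA _ PA_succ_zero dummy x). Qed.
Lemma pa_succ_inj x y : x ⊕ i = y ⊕ i -> x = y.
Proof. exact (MPA _ PA_succ_inj dummy x y). Qed.
Lemma pa_add_zero x : x ⊕ o = x.
Proof. exact (MPA _ PA_add_zero dummy x). Qed.
Lemma pa_add_succ x y : x ⊕ (y ⊕ i) = (x ⊕ y) ⊕ i.
Proof. exact (MPA _ PA_add_succ dummy x y). Qed.
Lemma pa_mul_zero x : x ⊗ o = o.
Proof. exact (MPA _ PA_mul_zero dummy x). Qed.
Lemma pa_mul_succ x y : x ⊗ (y ⊕ i) = x ⊗ y ⊕ x.
Proof. exact (MPA _ PA_mul_succ dummy x y). Qed.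
Lemma pa_lt x y : x ≺ y <-> exists z, x ⊕ (z ⊕ i) = y.
Proof.
  pose proof (MPA _ PA_lt dummy x y) as H. rewrite sat_Iff, sat_Ex in H.
  exact H.
Qed.

Lemma pa_zero_add x : o ⊕ x = x.
Proof.
  apply (pa_ind (Eq (Add Zero (Var 0)) (Var 0)) dummy); simpl.
  - apply pa_add_zero.
  - intros y H. rewrite pa_add_succ, H; reflexivity.
Qed.

Lemma pa_add_assoc x y z : x ⊕ (y ⊕ z) = x ⊕ y ⊕ z.
Proof.
  apply (pa_ind (Eq (Add (Var 1) (Add (Var 2) (Var 0)))
                    (Add (Add (Var 1) (Var 2)) (Var 0)))
                (scons x (scons y dummy))); simpl.
  - rewrite !pa_add_zero; reflexivity.
  - intros u H. rewrite !pa_add_succ, H; reflexivity.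
Qed.

Lemma pa_one_add x : i ⊕ x = x ⊕ i.
Proof.
  apply (pa_ind (Eq (Add One (Var 0)) (Add (Var 0) One)) dummy); simpl.
  - rewrite pa_add_zero, pa_zero_add; reflexivity.
  - intros y H. rewrite pa_add_succ, H; reflexivity.
Qed.

Lemma pa_add_comm x y : x ⊕ y = y ⊕ x.
Proof.
  apply (pa_ind (Eq (Add (Var 1) (Var 0)) (Add (Var 0) (Var 1)))
                (scons x dummy)); simpl.
  - rewrite pa_add_zero, pa_zero_add; reflexivity.
  - intros u H. rewrite pa_add_succ, H, <- pa_add_assoc, <- (pa_one_add x), pa_add_assoc.
    reflexivity.
Qed.

Lemma pa_add_cancel x y z : x ⊕ z = y ⊕ z -> x = y.
Proof.
  apply (pa_ind (Imp (Eq (Add (Var 1) (Var 0)) (Add (Var 2) (Var 0)))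
                     (Eq (Var 1) (Var 2)))
                (scons x (scons y dummy))); simpl.
  - rewrite !pa_add_zero; auto.
  - intros u H E. rewrite !pa_add_succ in E. apply H, pa_succ_inj, E.
Qed.

Lemma pa_mul_add x y z : x ⊗ (y ⊕ z) = x ⊗ y ⊕ x ⊗ z.
Proof.
  apply (pa_ind (Eq (Mul (Var 1) (Add (Var 2) (Var 0)))
                    (Add (Mul (Var 1) (Var 2)) (Mul (Var 1) (Var 0))))
                (scons x (scons y dummy))); simpl.
  - rewrite pa_mul_zero, !pa_add_zero; reflexivity.
  - intros u H. rewrite pa_add_succ, !pa_mul_succ, H, pa_add_assoc; reflexivity.
Qed.

Lemma pa_mul_assoc x y z : x ⊗ (y ⊗ z) = x ⊗ y ⊗ z.
Proof.
  apply (pa_ind (Eq (Mul (Var 1) (Mul (Var 2) (Var 0)))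
                    (Mul (Mul (Var 1) (Var 2)) (Var 0)))
                (scons x (scons y dummy))); simpl.
  - rewrite !pa_mul_zero; reflexivity.
  - intros u H. rewrite !pa_mul_succ, pa_mul_add, H; reflexivity.
Qed.

Lemma pa_mul_one x : x ⊗ i = x.
Proof. rewrite <- (pa_zero_add i), pa_mul_succ, pa_mul_zero, pa_zero_add; reflexivity. Qed.

Lemma pa_zero_mul x : o ⊗ x = o.
Proof.
  apply (pa_ind (Eq (Mul Zero (Var 0)) Zero) dummy); simpl.
  - apply pa_mul_zero.
  - intros y H. rewrite pa_mul_succ, H, pa_add_zero; reflexivity.
Qed.

Lemma pa_add_mul x y z : (x ⊕ y) ⊗ z = x ⊗ z ⊕ y ⊗ z.
Proof.
  apply (pa_ind (Eq (Mul (Add (Var 1) (Var 2)) (Var 0))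
                    (Add (Mul (Var 1) (Var 0)) (Mul (Var 2) (Var 0))))
                (scons x (scons y dummy))); simpl.
  - rewrite !pa_mul_zero, pa_add_zero; reflexivity.
  - intros u H. rewrite !pa_mul_succ, H, <- !pa_add_assoc.
    f_equal. rewrite !pa_add_assoc. f_equal. apply pa_add_comm.
Qed.

Lemma pa_one_mul x : i ⊗ x = x.
Proof.
  apply (pa_ind (Eq (Mul One (Var 0)) (Var 0)) dummy); simpl.
  - apply pa_mul_zero.
  - intros y H. rewrite pa_mul_succ, H; reflexivity.
Qed.

Lemma pa_mul_comm x y : x ⊗ y = y ⊗ x.
Proof.
  apply (pa_ind (Eq (Mul (Var 1) (Var 0)) (Mul (Var 0) (Var 1)))
                (scons x dummy)); simpl.
  - rewrite pa_mul_zero, pa_zero_mul; reflexivity.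
  - intros u H. rewrite pa_mul_succ, pa_add_mul, H, pa_one_mul; reflexivity.
Qed.

(** There is no subtraction in [M]; the later identities are therefore arranged so that both sides
    are sums and [ring] applies. *)
Lemma pa_semiring : semi_ring_theory o i (s_add M) (s_mul M) (@eq M).
Proof.
  constructor.
  - apply pa_zero_add.
  - apply pa_add_comm.
  - apply pa_add_assoc.
  - apply pa_one_mul.
  - apply pa_zero_mul.
  - apply pa_mul_comm.
  - apply pa_mul_assoc.
  - apply pa_add_mul.
Qed.

Add Ring pa_ring : pa_semiring.

Lemma pa_zero_or_succ x : x = o \/ exists y, x = y ⊕ i.
Proof.
  assert (H : sat M (scons x dummy)
    (Imp (Neg (Eq (Var 0) Zero)) (Ex (Eq (Var 1) (Add (Var 0) One))))).
  { apply pa_ind.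
    - intros H; exfalso; apply H; reflexivity.
    - intros y _ _. apply sat_Ex. exists y. reflexivity. }
  destruct (classic (x = o)) as [E|E]; auto. right.
  specialize (H E). apply sat_Ex in H. exact H.
Qed.

Lemma pa_total x y : x ≺ y \/ x = y \/ y ≺ x.
Proof.
  assert (H : sat M (scons x (scons y dummy))
    (Imp (Neg (Lt (Var 0) (Var 1))) (Imp (Neg (Eq (Var 0) (Var 1)))
      (Lt (Var 1) (Var 0))))).
  { apply pa_ind; simpl.
    - intros H1 H2. destruct (pa_zero_or_succ y) as [E|[z E]]; [congruence|].
      exfalso; apply H1, pa_lt. exists z. rewrite pa_zero_add; auto.
    - intros u IH H1 H2.
      destruct (classic (u = y)) as [E|E].
      { subst. apply pa_lt. exists o. ring. }
      destruct (classic (u ≺ y)) as [L|L].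
      { apply pa_lt in L. destruct L as [z Hz].
        destruct (pa_zero_or_succ z) as [Ez|[w Ew]]; subst.
        - exfalso; apply H2; ring.
        - exfalso; apply H1, pa_lt. exists w. ring. }
      specialize (IH L E). apply pa_lt in IH. destruct IH as [z Hz].
      apply pa_lt. exists (z ⊕ i). rewrite <- Hz. ring. }
  simpl in H. tauto.
Qed.

Lemma pa_add_zero_inv x y : x ⊕ y = o -> y = o.
Proof.
  intros E. destruct (pa_zero_or_succ y) as [|[z ->]]; auto.
  rewrite pa_add_assoc in E. exfalso; eapply pa_succ_zero; eauto.
Qed.

Lemma pa_lt_irrefl x : ~ x ≺ x.
Proof.
  rewrite pa_lt. intros [z Hz]. rewrite pa_add_comm in Hz.
  rewrite <- (pa_zero_add x) in Hz at 2. apply pa_add_cancel in Hz.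
  eapply pa_succ_zero; eauto.
Qed.

Lemma pa_lt_trans x y z : x ≺ y -> y ≺ z -> x ≺ z.
Proof.
  rewrite !pa_lt. intros [u Hu] [v Hv]. exists (u ⊕ i ⊕ v). subst. ring.
Qed.

Lemma pa_lt_add x y z : x ≺ y -> x ≺ y ⊕ z.
Proof. rewrite !pa_lt. intros [u Hu]. exists (u ⊕ z). subst. ring. Qed.

Lemma pa_not_lt_zero x : ~ x ≺ o.
Proof. rewrite pa_lt. intros [z Hz]. apply pa_add_zero_inv in Hz. eapply pa_succ_zero; eauto. Qed.

Lemma pa_lt_succ x y : x ≺ y ⊕ i <-> x ≺ y \/ x = y.
Proof.
  rewrite !pa_lt. split.
  - intros [z Hz]. rewrite pa_add_assoc in Hz. apply pa_succ_inj in Hz.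
    destruct (pa_zero_or_succ z) as [->|[w ->]].
    + right. rewrite <- Hz; ring.
    + left. exists w; auto.
  - intros [[z Hz]| ->]; [exists (z ⊕ i)|exists o]; subst; ring.
Qed.

Lemma value_S n : value M (S n) = value M n ⊕ i.
Proof. reflexivity. Qed.

Lemma value_add m n : value M (m + n) = value M m ⊕ value M n.
Proof.
  induction m; simpl; [symmetry; apply pa_zero_add|]. rewrite IHm. ring.
Qed.

Lemma value_mul m n : value M (m * n) = value M m ⊗ value M n.
Proof.
  induction m; simpl; [symmetry; apply pa_zero_mul|]. rewrite value_add, IHm. ring.
Qed.

Lemma value_one : value M 1 = i.
Proof. apply pa_zero_add. Qed.

Lemma value_inj m n : value M m = value M n -> m = n.
Proof.
  revert n; induction m; intros [|n] E; simpl in *; auto.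
  - symmetry in E; exfalso; eapply pa_succ_zero; eauto.
  - exfalso; eapply pa_succ_zero; eauto.
  - f_equal. apply IHm, pa_succ_inj, E.
Qed.

(** The standard part is an initial segment. This is what makes bounded quantifiers with standard
    bounds absolute. *)
Lemma lt_value x n : x ≺ value M n <-> exists k, k < n /\ x = value M k.
Proof.
  induction n; simpl.
  - split; [intros H; exfalso; eapply pa_not_lt_zero; eauto|intros [k [Hk _]]; lia].
  - rewrite pa_lt_succ, IHn. split.
    + intros [[k [Hk E]]|E]; [exists k|exists n]; split; auto.
    + intros [k [Hk E]]. destruct (Nat.eq_dec k n) as [->|]; auto.
      left; exists k; split; auto; lia.
Qed.

Lemma value_lt m n : value M m ≺ value M n <-> m < n.
Proof.
  rewrite lt_value. split.
  - intros [k [Hk E]]. apply value_inj in E. lia.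
  - eauto.
Qed.

Lemma nonstandard_gt x n : (forall k, x <> value M k) -> value M n ≺ x.
Proof.
  intros H. destruct (pa_total (value M n) x) as [L|[E|L]]; auto.
  - exfalso; eapply H; eauto.
  - apply lt_value in L. destruct L as [k [_ E]]. exfalso; eapply H; eauto.
Qed.

Lemma teval_value (r : nat -> nat) t :
  teval M (fun n => value M (r n)) t = value M (teval std r t).
Proof.
  induction t; simpl; auto.
  - symmetry; apply value_one.
  - rewrite IHt1, IHt2, <- value_add; reflexivity.
  - rewrite IHt1, IHt2, <- value_mul; reflexivity.
Qed.

(** Uniqueness of remainders: if one quotient were larger, the other remainder would contain a whole
    [m]. *)
Lemma pa_mul_lt_cancel m q q' v v' :
  q ⊗ m ⊕ v = q' ⊗ m ⊕ v' -> v ≺ m -> v' ≺ m -> v = v'.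
Proof.
  assert (K : forall a b u w, a ≺ b -> a ⊗ m ⊕ u = b ⊗ m ⊕ w -> u ≺ m -> False).
  { intros a b u w L E Hu. apply pa_lt in L as [z <-].
    assert (E' : u = m ⊕ (z ⊗ m ⊕ w)).
    { apply (pa_add_cancel _ _ (a ⊗ m)). rewrite pa_add_comm, E. ring. }
    apply (pa_lt_irrefl u). rewrite E' at 2. apply pa_lt_add, Hu. }
  intros E Hv Hv'. destruct (pa_total q q') as [L|[->|L]].
  - exfalso; eapply K; eauto.
  - apply (pa_add_cancel _ _ (q' ⊗ m)). rewrite pa_add_comm, E; ring.
  - exfalso; eapply K; eauto.
Qed.

End Arithmetic.

(** * Gödel's beta function *)

Definition tmod (b i : term) : term := Add (Mul (Add i One) b) One.

Definition modulus (M : structure) (b i : M) : M :=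
  s_add M (s_mul M (s_add M i (s_one M)) b) (s_one M).

Definition beta (M : structure) (a b i v : M) : Prop :=
  s_lt M v (modulus M b i) /\
  exists q, a = s_add M (s_mul M q (modulus M b i)) v.

(** Membership of [i] in the set coded by [a], [b] means remainder 0 at the beta modulus, which is a
    single divisibility. *)
Definition bit (M : structure) (a b i : M) : Prop :=
  exists q, a = s_mul M q (modulus M b i).

Definition beta_form : form :=
  And (Lt (Var 3) (tmod (Var 1) (Var 2)))
      (Ex (Eq (Var 1) (Add (Mul (Var 0) (tmod (Var 2) (Var 3))) (Var 4)))).

Definition bit_form : form :=
  Ex (Eq (Var 1) (Mul (Var 0) (tmod (Var 2) (Var 3)))).

Lemma sat_beta (M : structure) (r : nat -> M) :
  sat M r beta_form <-> beta M (r 0) (r 1) (r 2) (r 3).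
Proof. unfold beta_form. rewrite sat_And, sat_Ex. reflexivity. Qed.

Lemma sat_bit (M : structure) (r : nat -> M) :
  sat M r bit_form <-> bit M (r 0) (r 1) (r 2).
Proof. unfold bit_form. rewrite sat_Ex. reflexivity. Qed.

Section Beta.
Variable M : structure.
Hypothesis MPA : models M PA.

Notation "x ⊕ y" := (s_add M x y) (at level 50, left associativity).
Notation "x ⊗ y" := (s_mul M x y) (at level 40, left associativity).
Notation o := (s_zero M).
Notation i := (s_one M).
Notation "x ≺ y" := (s_lt M x y) (at level 70).

Add Ring pa_ring2 : (pa_semiring M MPA).

Lemma beta_unique a b n v v' : beta M a b n v -> beta M a b n v' -> v = v'.
Proof.
  intros [L [q E]] [L' [q' E']]. apply (pa_mul_lt_cancel M MPA (modulus M b n) q q'); auto. congruence.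
Qed.

(** Stands in for a multiple of the factorial of [K]: Gödel's moduli over such a [d] are pairwise
    coprime. *)
Definition divided_up_to (K : nat) (d : M) : Prop :=
  d <> o /\ forall j, 1 <= j <= K -> exists e, value M j ⊗ e = d.

Lemma modulus_inverse K d k l : divided_up_to K d -> k < l <= K ->
  exists u w, modulus M d (value M k) ⊗ u = i ⊕ modulus M d (value M l) ⊗ w.
Proof.
  intros [Hd HK] [L1 L2]. destruct (HK (l - k)) as [e He]; [lia|].
  assert (El : value M l = value M k ⊕ value M (l - k))
    by (rewrite <- (value_add M MPA); f_equal; lia).
  destruct (pa_zero_or_succ M MPA e) as [->|[e' ->]].
  { exfalso; apply Hd. rewrite <- He. ring. }
  set (I := value M k) in *. set (J := value M l) in *. set (D := value M (l - k)) in *.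
  (* The combination (J+1)m_I - (I+1)m_J of the two moduli equals J - I, and e(J - I) = d.
     Multiplying by e(J+1) gives (J+1)d = m_J - 1, so x = m_I U satisfies x + 1 = m_J W. Squaring
     removes the sign: with b = x - 1, x * x = 1 + b(x + 1). Here [s] is the predecessor of [U]. *)
  pose (s := (J ⊕ i) ⊗ (e' ⊕ i) ⊗ J ⊕ (J ⊕ i) ⊗ e' ⊕ J).
  pose (U := (J ⊕ i) ⊗ (e' ⊕ i) ⊗ (J ⊕ i)).
  pose (b := (I ⊕ i) ⊗ d ⊗ (s ⊕ i) ⊕ s).
  pose (W := (I ⊕ i) ⊗ (e' ⊕ i) ⊗ (J ⊕ i) ⊕ i).
  assert (EU : U = s ⊕ i) by (unfold U, s; ring).
  assert (Ea : modulus M d I ⊗ U = b ⊕ i) by (rewrite EU; unfold modulus, b; ring).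
  assert (EW : modulus M d I ⊗ U ⊕ i = modulus M d J ⊗ W).
  { unfold U, W, modulus. rewrite <- He. rewrite El. ring. }
  exists (U ⊗ (b ⊕ i)), (b ⊗ W).
  replace (modulus M d I ⊗ (U ⊗ (b ⊕ i))) with (modulus M d I ⊗ U ⊗ (b ⊕ i)) by ring.
  replace (modulus M d J ⊗ (b ⊗ W)) with (b ⊗ (modulus M d J ⊗ W)) by ring.
  rewrite <- EW, Ea. ring.
Qed.

(** The induction runs on the standard length outside [M]. It carries along the product [P] of the
    moduli treated so far, which stays invertible modulo each later one. *)
Lemma chinese K d (v : nat -> M) : divided_up_to K d -> forall k, k <= K ->
  exists c, forall j, j < k -> exists q, c = q ⊗ modulus M d (value M j) ⊕ v j.
Proof.
  intros Hd.
  assert (H : forall k, k <= K ->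
    (exists P, (forall j, j < k -> exists w, P = w ⊗ modulus M d (value M j)) /\
      forall l, k <= l <= K -> exists u w, P ⊗ u = i ⊕ modulus M d (value M l) ⊗ w) /\
    exists c, forall j, j < k -> exists q, c = q ⊗ modulus M d (value M j) ⊕ v j).
  { induction k; intros Hk.
    - split; [|exists o; intros; lia].
      exists i. split; [intros; lia|]. intros l _. exists i, o. ring.
    - destruct IHk as [[P [HP1 HP2]] [c Hc]]; [lia|]. split.
      + exists (P ⊗ modulus M d (value M k)). split.
        * intros j Hj. destruct (Nat.eq_dec j k) as [->|Hn].
          -- exists P. reflexivity.
          -- destruct (HP1 j) as [w ->]; [lia|].
             exists (w ⊗ modulus M d (value M k)). ring.
        * intros l Hl. destruct (HP2 l) as [u [w E]]; [lia|].
          destruct (modulus_inverse K d k l Hd) as [u' [w' E']]; [lia|].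
          exists (u ⊗ u'), (w ⊕ w' ⊕ modulus M d (value M l) ⊗ w ⊗ w').
          replace (P ⊗ modulus M d (value M k) ⊗ (u ⊗ u'))
            with ((P ⊗ u) ⊗ (modulus M d (value M k) ⊗ u')) by ring.
          rewrite E, E'. ring.
      + destruct (HP2 k) as [u [w E]]; [lia|].
        (* As [g] is the new modulus minus 1, it acts as -1 modulo it. Since P u is 1 there, c + P u
           (v_k + g c) has residue v_k, while the earlier residues are untouched because their
           moduli divide [P]. *)
        set (g := (value M k ⊕ i) ⊗ d).
        exists (c ⊕ P ⊗ (u ⊗ (v k ⊕ g ⊗ c))). intros j Hj.
        destruct (Nat.eq_dec j k) as [->|Hn].
        * exists (c ⊕ w ⊗ (v k ⊕ g ⊗ c)).
          replace (P ⊗ (u ⊗ (v k ⊕ g ⊗ c))) with ((P ⊗ u) ⊗ (v k ⊕ g ⊗ c)) by ring.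
          rewrite E. unfold modulus. fold g. ring.
        * destruct (Hc j) as [q Hq]; [lia|]. destruct (HP1 j) as [z Hz]; [lia|].
          exists (q ⊕ z ⊗ (u ⊗ (v k ⊕ g ⊗ c))). rewrite Hq at 1. rewrite Hz. ring. }
  intros k Hk. apply H, Hk.
Qed.

Lemma common_divided K (v : nat -> M) :
  exists d, divided_up_to K d /\ forall j, j < K -> exists z, v j ⊕ z = d.
Proof.
  induction K.
  - exists i. repeat split; try (intros; lia).
    intros E. apply (pa_succ_zero M MPA o). rewrite E; ring.
  - destruct IHK as [d [[Hd HK] Hv]].
    destruct (pa_zero_or_succ M MPA d) as [|[d0 E0]]; [contradiction|].
    set (k := value M K) in *.
    (* The factor [k ⊕ i] is the value of [S K] and gives the new divisor; the factor [v K ⊕ i]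
       lifts the product above the new entry. *)
    pose (d' := d ⊗ (k ⊕ i) ⊗ (v K ⊕ i)).
    exists d'. split; [split|].
    + unfold d'. rewrite E0. intros E.
      apply (pa_succ_zero M MPA ((d0 ⊕ i) ⊗ (k ⊕ i) ⊗ v K ⊕ (d0 ⊕ i) ⊗ k ⊕ d0)).
      rewrite <- E. ring.
    + intros j Hj. destruct (Nat.eq_dec j (S K)) as [->|Hn].
      * exists (d ⊗ (v K ⊕ i)). rewrite value_S. fold k. unfold d'. ring.
      * destruct (HK j) as [e He]; [lia|].
        exists (e ⊗ (k ⊕ i) ⊗ (v K ⊕ i)). unfold d'. rewrite <- He. ring.
    + intros j Hj. destruct (Nat.eq_dec j K) as [->|Hn].
      * exists (i ⊕ (d0 ⊗ k ⊕ d0 ⊕ k) ⊗ v K ⊕ (d0 ⊗ k ⊕ d0 ⊕ k)).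
        unfold d'. rewrite E0. ring.
      * destruct (Hv j) as [z Hz]; [lia|].
        exists (z ⊕ d ⊗ (k ⊗ v K ⊕ k ⊕ v K)). unfold d'.
        transitivity ((v j ⊕ z) ⊕ d ⊗ (k ⊗ v K ⊕ k ⊕ v K)); [ring|].
        rewrite Hz. ring.
Qed.

(** Only standardly many entries are coded, so [v] may be an arbitrary external function into
    [M]. *)
Lemma beta_sequence K (v : nat -> M) :
  exists a b, forall j, j < K -> beta M a b (value M j) (v j).
Proof.
  destruct (common_divided K v) as [d [Hd Hv]].
  destruct (chinese K d v Hd K (le_n K)) as [c Hc].
  exists c, d. intros j Hj. split.
  - destruct (Hv j Hj) as [z Hz]. apply (pa_lt M MPA).
    exists (z ⊕ value M j ⊗ d). unfold modulus. rewrite <- Hz. ring.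
  - apply Hc, Hj.
Qed.

Lemma bit_set K (S : nat -> Prop) :
  exists a b, forall j, j < K -> (bit M a b (value M j) <-> S j).
Proof.
  pose (v := fun j => if excluded_middle_informative (S j) then o else i).
  destruct (common_divided K v) as [d [Hd _]].
  destruct (chinese K d v Hd K (le_n K)) as [c Hc].
  exists c, d. intros j Hj. destruct (Hc j Hj) as [q Hq].
  unfold v in Hq. destruct (excluded_middle_informative (S j)) as [Y|Nn].
  - split; auto. intros _. exists q. rewrite Hq. ring.
  - split; [|tauto]. intros [q' Hq']. exfalso.
    destruct Hd as [Hd _].
    destruct (pa_zero_or_succ M MPA d) as [|[d0 E0]]; [contradiction|].
    assert (L : forall x, x = o \/ x = i -> x ≺ modulus M d (value M j)).
    { intros x [->| ->]; apply (pa_lt M MPA); unfold modulus; rewrite E0.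
      - exists ((value M j ⊕ i) ⊗ (d0 ⊕ i)). ring.
      - exists (value M j ⊗ d0 ⊕ value M j ⊕ d0). ring. }
    assert (E : o = i).
    { apply (pa_mul_lt_cancel M MPA (modulus M d (value M j)) q' q); auto.
      rewrite <- Hq, Hq'. ring. }
    apply (pa_succ_zero M MPA o). rewrite E at 2. ring.
Qed.

End Beta.

Lemma std_bit a b j : bit std a b j <-> exists q, q <= a /\ a = q * ((j + 1) * b + 1).
Proof.
  unfold bit, modulus; simpl. split.
  - intros [q ->]. exists q. split; auto. nia.
  - intros [q [_ H]]. eauto.
Qed.

Lemma bit_pattern n D B (S : nat -> Prop) :
  0 < D -> (forall j, j < n -> exists q, D = q * (j + 1)) ->
  0 < B -> (forall j, j < n -> exists q, B = q * ((j + 1) * D + 1)) ->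
  exists c, c < B /\ forall j, j < n -> (bit std c D j <-> S j).
Proof.
  intros HD Hdiv HB HmB.
  assert (Hd : divided_up_to std n D).
  { split; [simpl; lia|]. intros j Hj. rewrite std_value.
    destruct (Hdiv (j - 1)) as [q Hq]; [lia|]. exists q. simpl.
    rewrite Hq. replace (j - 1 + 1) with j by lia. lia. }
  pose (v := fun j => if excluded_middle_informative (S j) then 0 else 1).
  destruct (chinese std std_PA n D v Hd n (le_n n)) as [c Hc].
  (* [B] is a multiple of all the moduli, so reduction modulo [B] bounds the code without changing
     any residue. *)
  exists (c mod B). split; [apply Nat.mod_upper_bound; lia|]. intros j Hj.
  destruct (Hc j Hj) as [q Hq]. rewrite std_value in Hq. unfold modulus in Hq. simpl in Hq.
  destruct (HmB j Hj) as [w Hw]. set (m := (j + 1) * D + 1) in *.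
  assert (Hm : m > 1) by (unfold m; nia).
  assert (E : (c mod B) mod m = v j mod m).
  { pose proof (Nat.div_mod_eq c B) as Ec. remember (c mod B) as c0. remember (c / B) as k.
    rewrite <- (Nat.Div0.mod_add c0 (k * w) m), <- (Nat.Div0.mod_add (v j) q m).
    f_equal. rewrite Hw in Ec. simpl in *. nia. }
  transitivity ((c mod B) mod m = 0).
  - unfold bit, modulus; simpl. fold m. split.
    + intros [z ->]. apply Nat.Div0.mod_mul.
    + intros H. apply Nat.Div0.mod_divides in H. destruct H as [z Hz]. exists z.
      rewrite Hz at 1. lia.
  - rewrite E. unfold v. destruct (excluded_middle_informative (S j)) as [Y|Nn].
    + rewrite Nat.Div0.mod_0_l. tauto.
    + rewrite Nat.mod_small by lia. split; [discriminate|tauto].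
Qed.

Lemma bit_moduli n : exists D B,
  0 < D /\ (forall j, j < n -> exists q, D = q * (j + 1)) /\
  0 < B /\ (forall j, j < n -> exists q, B = q * ((j + 1) * D + 1)).
Proof.
  assert (HD : exists D, 0 < D /\ (forall j, j < n -> exists q, D = q * (j + 1))).
  { induction n as [|n [D [H0 H]]]; [exists 1; split; [lia|intros; lia]|].
    exists (D * (n + 1)). split; [nia|]. intros j Hj.
    destruct (Nat.eq_dec j n) as [->|]; [exists D; reflexivity|].
    destruct (H j) as [q ->]; [lia|]. exists (q * (n + 1)). nia. }
  destruct HD as [D [H0 H]]. exists D.
  assert (HB : forall k, exists B, 0 < B /\
     (forall j, j < k -> exists q, B = q * ((j + 1) * D + 1))).
  { induction k as [|k [B [K0 K]]]; [exists 1; split; [lia|intros; lia]|].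
    exists (B * ((k + 1) * D + 1)). split; [nia|]. intros j Hj.
    destruct (Nat.eq_dec j k) as [->|]; [exists B; reflexivity|].
    destruct (K j) as [q ->]; [lia|]. exists (q * ((k + 1) * D + 1)). nia. }
  destruct (HB n) as [B [K0 K]]. exists B. auto.
Qed.

(** * Ultraproducts *)

Record ultrafilter (I : Type) (U : (I -> Prop) -> Prop) : Prop := {
  uf_false : ~ U (fun _ => False);
  uf_and : forall P Q, U P -> U Q -> U (fun x => P x /\ Q x);
  uf_mono : forall P Q : I -> Prop, (forall x, P x -> Q x) -> U P -> U Q;
  uf_em : forall P, U P \/ U (fun x => ~ P x)
}.

Lemma ultrafilter_extends (I J : Type) (j0 : J) (F : J -> I -> Prop) :
  (forall j, exists x, F j x) ->
  (forall j k, exists l, forall x, F l x -> F j x /\ F k x) ->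
  exists U, ultrafilter I U /\ forall j, U (F j).
Proof.
  intros Hne Hdir.
  pose (G := fun P : I -> Prop => exists j, forall x, F j x -> P x).
  assert (HG : @filter.ProperFilter I G).
  { split.
    - intros [j Hj]. destruct (Hne j) as [x Hx]. exact (Hj x Hx).
    - split.
      + exists j0. intros; exact Logic.I.
      + intros P Q [j Hj] [k Hk]. destruct (Hdir j k) as [l Hl]. exists l.
        intros x Hx. destruct (Hl x Hx). split; auto.
      + intros P Q HPQ [j Hj]. exists j. intros x Hx. apply HPQ, Hj, Hx. }
  destruct (filter.ultraFilterLemma HG) as [U [HU HGU]].
  destruct HU as [[U0 [UT UI US]] Umax].
  exists U. split.
  - split.
    + exact U0.
    + intros P Q HP HQ. exact (UI P Q HP HQ).
    + intros P Q H HP. exact (US P Q H HP).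
    + intros P. destruct (classic (U (fun x => ~ P x))) as [|Hn]; [auto|left].
      (* [V] is the filter generated by [U] and [P]. It is proper because the complement of [P] is
         not in [U], so maximality gives [V = U], and [P] belongs to [V]. *)
      pose (V := fun Q : I -> Prop => exists R, U R /\ forall x, R x /\ P x -> Q x).
      assert (HV : @filter.ProperFilter I V).
      { split.
        - intros [R [HR H]]. apply Hn. apply (US R); auto.
          intros x Hx Px. exact (H x (conj Hx Px)).
        - split.
          + exists (fun _ => True). split; [exact UT|]. intros; exact Logic.I.
          + intros Q Q' [R [HR H]] [R' [HR' H']]. exists (fun x => R x /\ R' x).
            split; [apply (UI R R'); auto|]. intros x [[? ?] ?]. split; auto.
          + intros Q Q' HQ [R [HR H]]. exists R. split; [exact HR|].
            intros x Hx. apply HQ, H, Hx. }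
      rewrite <- (Umax V HV).
      { exists (fun _ => True). split; [exact UT|tauto]. }
      intros Q HQ. exists Q. split; [exact HQ|tauto].
  - intros j. apply HGU. exists j. auto.
Qed.

Section Quotient.
Variables (T : Type) (E : T -> T -> Prop).

(** Since [sat] reads [Eq] as equality, the quotient must have real equality. Extensionality makes
    [E x] and [E y] the same predicate for equivalent [x], [y], and equal predicates get the same
    choice. *)
Definition canon (x : T) : T := epsilon (inhabits x) (E x).

Definition quot : Type := { z | exists x, z = canon x }.

Definition cls (x : T) : quot := exist _ (canon x) (ex_intro _ x eq_refl).

Definition repr (a : quot) : T := proj1_sig a.

Hypothesis E_refl : forall x, E x x.
Hypothesis E_euclid : forall x y z, E x y -> E z y -> E x z.

Lemma repr_cls x : E x (repr (cls x)).
Proof. apply (epsilon_spec (inhabits x) (E x)). eauto. Qed.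

Lemma quot_eq a b : repr a = repr b -> a = b.
Proof.
  destruct a as [x Hx], b as [y Hy]; simpl. intros ->. f_equal. apply proof_irrelevance.
Qed.

Lemma cls_eq x y : cls x = cls y <-> E x y.
Proof.
  assert (class_sym : forall x y, E x y -> E y x) by (intros; eapply E_euclid; eauto).
  split.
  - intros H. pose proof (repr_cls x) as Hx. rewrite H in Hx.
    eapply E_euclid; [exact Hx|apply repr_cls].
  - intros H. apply quot_eq. simpl. unfold canon.
    assert (EE : E x = E y).
    { apply functional_extensionality; intros z. apply propositional_extensionality.
      split; intros; eauto. }
    rewrite EE. f_equal. apply proof_irrelevance.
Qed.

Lemma cls_surj a : exists x, a = cls x.
Proof. destruct a as [z [x ->]]. exists x. reflexivity. Qed.

End Quotient.

Section Ultraproduct.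
Variables (I : Type) (U : (I -> Prop) -> Prop) (HU : ultrafilter I U).
Variable N : I -> structure.

Let eqU (f g : forall x, N x) : Prop := U (fun x => f x = g x).

Lemma uf_all (P : I -> Prop) : (forall x, P x) -> U P.
Proof.
  intros H. destruct (uf_em I U HU P) as [|Hn]; auto.
  exfalso. apply (uf_false I U HU). revert Hn. apply (uf_mono I U HU). intros x Hx; auto.
Qed.

Lemma uf_iff (P Q : I -> Prop) : U (fun x => P x <-> Q x) -> (U P <-> U Q).
Proof.
  intros H; split; intros HP; generalize (uf_and I U HU _ _ H HP);
    apply (uf_mono I U HU); tauto.
Qed.

Lemma uf_not (P : I -> Prop) : U (fun x => ~ P x) <-> ~ U P.
Proof.
  split.
  - intros H HP. apply (uf_false I U HU). generalize (uf_and I U HU _ _ H HP).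
    apply (uf_mono I U HU). tauto.
  - destruct (uf_em I U HU P); tauto.
Qed.

Lemma uf_imp (P Q : I -> Prop) : U (fun x => P x -> Q x) <-> (U P -> U Q).
Proof.
  split.
  - intros H HP. generalize (uf_and I U HU _ _ H HP). apply (uf_mono I U HU). tauto.
  - intros H. destruct (uf_em I U HU P) as [HP|HP].
    + generalize (H HP). apply (uf_mono I U HU). tauto.
    + revert HP. apply (uf_mono I U HU). tauto.
Qed.

Lemma eqU_refl f : eqU f f.
Proof. apply uf_all. reflexivity. Qed.

Lemma eqU_euclid f g h : eqU f g -> eqU h g -> eqU f h.
Proof.
  intros H K. generalize (uf_and I U HU _ _ H K). apply (uf_mono I U HU).
  intros x [-> ->]; reflexivity.
Qed.

Definition ucls (f : forall x, N x) := cls _ eqU f.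

Definition urep (a : quot _ eqU) : forall x, N x := repr _ eqU a.

Lemma ucls_eq f g : ucls f = ucls g <-> eqU f g.
Proof. apply cls_eq; [exact eqU_refl|exact eqU_euclid]. Qed.

Lemma urep_ucls f : U (fun x => f x = urep (ucls f) x).
Proof. exact (repr_cls _ eqU eqU_refl f). Qed.

Definition ultraproduct : structure :=
  Structure (ucls (fun x => s_zero (N x))) (ucls (fun x => s_one (N x)))
    (fun a b => ucls (fun x => s_add (N x) (urep a x) (urep b x)))
    (fun a b => ucls (fun x => s_mul (N x) (urep a x) (urep b x)))
    (fun a b => U (fun x => s_lt (N x) (urep a x) (urep b x))).

Lemma ucls_teval (r : nat -> forall x, N x) t :
  teval ultraproduct (fun n => ucls (r n)) t =
  ucls (fun x => teval (N x) (fun n => r n x) t).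
Proof.
  induction t; simpl; auto; rewrite IHt1, IHt2; apply ucls_eq;
    generalize (uf_and I U HU _ _
      (urep_ucls (fun x => teval (N x) (fun n => r n x) t1))
      (urep_ucls (fun x => teval (N x) (fun n => r n x) t2)));
    apply (uf_mono I U HU); intros x [E1 E2]; rewrite <- E1, <- E2; reflexivity.
Qed.

Theorem los p : forall r : nat -> forall x, N x,
  sat ultraproduct (fun n => ucls (r n)) p <->
  U (fun x => sat (N x) (fun n => r n x) p).
Proof.
  induction p; intros r; simpl.
  - rewrite !ucls_teval, ucls_eq. reflexivity.
  - rewrite !ucls_teval. apply uf_iff.
    generalize (uf_and I U HU _ _
      (urep_ucls (fun x => teval (N x) (fun n => r n x) t))
      (urep_ucls (fun x => teval (N x) (fun n => r n x) t0))).
    apply (uf_mono I U HU). intros x [E1 E2]. rewrite <- E1, <- E2. reflexivity.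
  - split; [tauto|]. apply (uf_false I U HU).
  - rewrite IHp1, IHp2, uf_imp. reflexivity.
  - assert (K : forall f, sat ultraproduct (scons (ucls f) (fun n => ucls (r n))) p <->
                 U (fun x => sat (N x) (scons (f x) (fun n => r n x)) p)).
    { intros f. specialize (IHp (scons f r)).
      erewrite sat_ext; [rewrite IHp|intros [|n]; reflexivity].
      apply uf_iff, uf_all. intros x. apply sat_ext. intros [|n]; reflexivity. }
    split.
    + intros H. apply NNPP. rewrite <- uf_not. intros Hn.
      (* A counterexample is chosen in each coordinate where one exists; their class refutes the
         universal formula in the ultraproduct. *)
      pose (f := fun x => epsilon (inhabits (r 0 x))
                   (fun y => ~ sat (N x) (scons y (fun n => r n x)) p)).
      specialize (H (ucls f)). rewrite K in H.
      apply (uf_false I U HU). generalize (uf_and I U HU _ _ H Hn).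
      apply (uf_mono I U HU). intros x [H1 H2].
      apply not_all_ex_not in H2. apply (epsilon_spec (inhabits (r 0 x))) in H2.
      exact (H2 H1).
    + intros H a. destruct (cls_surj _ _ a) as [f ->]. fold (ucls f). apply K.
      revert H. apply (uf_mono I U HU). auto.
Qed.

Lemma ultraproduct_models A : (forall x, models (N x) A) -> models ultraproduct A.
Proof.
  intros H p Hp r.
  assert (K : exists r', forall n, r n = ucls (r' n)).
  { exists (fun n => epsilon (inhabits (urep (r n))) (fun f => r n = ucls f)).
    intros n. apply epsilon_spec, cls_surj. }
  destruct K as [r' E]. apply (sat_ext ultraproduct p r (fun n => ucls (r' n)) E).
  apply los, uf_all. intros x. apply H, Hp.
Qed.

End Ultraproduct.

(** * Absolute relations between standard numbers *)

Definition oracle : Type := nat -> nat -> nat -> nat -> Prop.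

Definition env6 {X : Type} (a b k i j l z : X) : nat -> X :=
  scons a (scons b (scons k (scons i (scons j (scons l (fun _ => z)))))).

Definition orc (w : form) (M : structure) (a b : M) : oracle :=
  fun k i j l => sat M (env6 a b (value M k) (value M i) (value M j) (value M l) (s_zero M)) w.

Fixpoint num (n : nat) : term :=
  match n with 0 => Zero | S m => Add (num m) One end.

Lemma teval_num (M : structure) (r : nat -> M) n : teval M r (num n) = value M n.
Proof. induction n; simpl; congruence. Qed.

(** Doubling removes the division by 2 from Cantor's pairing, so its graph becomes a polynomial
    equation. *)
Lemma cpair_eq x y z : z = cpair x y <-> z + z = (x + y) * (x + y + 1) + y + y.
Proof.
  assert (E : cpair x y + cpair x y = (x + y) * (x + y + 1) + y + y).
  { pose proof (Cantor.to_nat_spec x y) as H. unfold cpair. simpl in *. nia. }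
  lia.
Qed.

Lemma cpair_bound x y : cpair x y < (x + y + 1) * (x + y + 1).
Proof. pose proof (proj1 (cpair_eq x y _) eq_refl). nia. Qed.

Lemma cpair_ge x y : x + y <= cpair x y.
Proof. pose proof (proj1 (cpair_eq x y _) eq_refl). nia. Qed.

Lemma cleft_cpair x y : cleft (cpair x y) = x.
Proof. unfold cleft, cpair. rewrite Cantor.cancel_of_to. reflexivity. Qed.

Lemma cright_cpair x y : cright (cpair x y) = y.
Proof. unfold cright, cpair. rewrite Cantor.cancel_of_to. reflexivity. Qed.

Lemma cpair_surj n : cpair (cleft n) (cright n) = n.
Proof.
  unfold cpair, cleft, cright. rewrite <- surjective_pairing. apply Cantor.cancel_to_of.
Qed.

Lemma cpair_inj x y x' y' : cpair x y = cpair x' y' -> x = x' /\ y = y'.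
Proof.
  intros E. split.
  - rewrite <- (cleft_cpair x y), E. apply cleft_cpair.
  - rewrite <- (cright_cpair x y), E. apply cright_cpair.
Qed.

Section Absolute.
Variable w : form.

(** A relation on standard numbers is absolute when one formula defines it in
    all models of PA; the possibly nonstandard parameters [a] and [b] may enter
    only through the oracle given by [w]. *)
Definition Abs (P : oracle -> (nat -> nat) -> Prop) : Prop :=
  exists p : form, forall (M : structure) (a b : M) (r : nat -> nat),
    models M PA ->
    (sat M (scons a (scons b (fun n => value M (r n)))) p <-> P (orc w M a b) r).

(** Instead of asking for a definable graph and a bound, [Fn f] asks that
    substituting [f] preserves absoluteness; this composes for free. *)
Definition Fn (f : (nat -> nat) -> nat) : Prop :=
  forall (s : nat -> nat) (P : oracle -> nat -> (nat -> nat) -> Prop),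
    Abs (fun O r => P O (r 0) (fun n => r (S n))) ->
    Abs (fun O r => P O (f (fun n => r (s n))) r).

Lemma Abs_iff (P Q : oracle -> (nat -> nat) -> Prop) :
  (forall O r, Q O r <-> P O r) -> Abs P -> Abs Q.
Proof. intros H [p Hp]. exists p. intros. rewrite Hp, H; auto. reflexivity. Qed.

Lemma Abs_term (s : nat -> term) (P : oracle -> (nat -> nat) -> Prop) :
  Abs P -> Abs (fun O r => P O (fun n => teval std r (s n))).
Proof.
  intros [p Hp].
  exists (subst (scons (Var 0) (scons (Var 1)
    (fun n => tsubst (fun k => Var (S (S k))) (s n)))) p).
  intros M a b r HM. rewrite sat_subst, <- (Hp M a b _ HM). apply sat_ext.
  intros [|[|n]]; try reflexivity. cbn [scons].
  rewrite teval_subst. simpl. apply teval_value, HM.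
Qed.

Lemma Abs_ren (s : nat -> nat) (P : oracle -> (nat -> nat) -> Prop) :
  Abs P -> Abs (fun O r => P O (fun n => r (s n))).
Proof. exact (Abs_term (fun n => Var (s n)) P). Qed.

Lemma Abs_bot : Abs (fun O r => False).
Proof. exists Bot. simpl. tauto. Qed.

Lemma Abs_imp P Q : Abs P -> Abs Q -> Abs (fun O r => P O r -> Q O r).
Proof.
  intros [p Hp] [q Hq]. exists (Imp p q). intros M a b r HM. simpl.
  rewrite Hp, Hq; auto. reflexivity.
Qed.

Lemma Abs_not P : Abs P -> Abs (fun O r => ~ P O r).
Proof. intros H. apply (Abs_imp _ _ H Abs_bot). Qed.

Lemma Abs_and P Q : Abs P -> Abs Q -> Abs (fun O r => P O r /\ Q O r).
Proof.
  intros [p Hp] [q Hq]. exists (And p q). intros M a b r HM.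
  rewrite sat_And, Hp, Hq; auto. reflexivity.
Qed.

Lemma Abs_or P Q : Abs P -> Abs Q -> Abs (fun O r => P O r \/ Q O r).
Proof.
  intros HP HQ. apply (Abs_iff (fun O r => ~ (~ P O r /\ ~ Q O r))).
  - intros; tauto.
  - apply Abs_not, Abs_and; apply Abs_not; assumption.
Qed.

Lemma Fn_var n : Fn (fun r => r n).
Proof.
  intros s P H. exact (Abs_ren (fun k => match k with 0 => s n | S k => k end) _ H).
Qed.

Lemma Fn_const c : Fn (fun r => c).
Proof.
  intros s P H.
  apply (Abs_iff (fun O r => P O (teval std r (num c)) r)).
  - intros O r. rewrite teval_num, std_value. reflexivity.
  - exact (Abs_term (fun k => match k with 0 => num c | S k => Var k end) _ H).
Qed.

Lemma Fn_op2 (G : nat -> nat -> nat) :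
  (forall P, Abs (fun O r => P O (r 0) (fun n => r (S n))) ->
     Abs (fun O r => P O (G (r 1) (r 0)) (fun n => r (S (S n))))) ->
  forall f g, Fn f -> Fn g -> Fn (fun r => G (f r) (g r)).
Proof.
  intros HG f g Hf Hg s P H.
  refine (Hf s (fun O x r => P O (G x (g (fun n => r (s n)))) r) _).
  refine (Hg (fun n => S (s n)) (fun O y r => P O (G (r 0) y) (fun n => r (S n))) _).
  exact (HG P H).
Qed.

Lemma Fn_add f g : Fn f -> Fn g -> Fn (fun r => f r + g r).
Proof.
  apply Fn_op2. intros P H.
  exact (Abs_term (fun k => match k with 0 => Add (Var 1) (Var 0) | S k => Var (S (S k)) end) _ H).
Qed.

Lemma Fn_mul f g : Fn f -> Fn g -> Fn (fun r => f r * g r).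
Proof.
  apply Fn_op2. intros P H.
  exact (Abs_term (fun k => match k with 0 => Mul (Var 1) (Var 0) | S k => Var (S (S k)) end) _ H).
Qed.

Lemma Fn_S f : Fn f -> Fn (fun r => S (f r)).
Proof.
  intros Hf s P H. refine (Hf s (fun O x r => P O (S x) r) _).
  apply (Abs_iff (fun O r => P O (r 0 + 1) (fun n => r (S n)))).
  - intros O r. rewrite Nat.add_1_r. reflexivity.
  - exact (Abs_term (fun k => match k with 0 => Add (Var 0) One | S k => Var (S k) end) _ H).
Qed.

Lemma Abs_Fn (f : (nat -> nat) -> nat) (P : oracle -> nat -> (nat -> nat) -> Prop) :
  Fn f -> Abs (fun O r => P O (r 0) (fun n => r (S n))) -> Abs (fun O r => P O (f r) r).
Proof. intros Hf H. exact (Hf (fun n => n) P H). Qed.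

Lemma Fn_ren (s : nat -> nat) f : Fn f -> Fn (fun r => f (fun n => r (s n))).
Proof. intros Hf s' P H. exact (Hf (fun n => s' (s n)) P H). Qed.

Lemma Abs_Fn2 (f g : (nat -> nat) -> nat) (R : oracle -> nat -> nat -> Prop) :
  Fn f -> Fn g -> Abs (fun O r => R O (r 0) (r 1)) -> Abs (fun O r => R O (f r) (g r)).
Proof.
  intros Hf Hg H. apply (Abs_Fn f (fun O x r => R O x (g r)) Hf).
  apply (Abs_Fn _ (fun O y r => R O (r 0) y) (Fn_ren S g Hg)).
  exact (Abs_ren (fun k => match k with 0 => 1 | _ => 0 end) _ H).
Qed.

Lemma Abs_eq f g : Fn f -> Fn g -> Abs (fun O r => f r = g r).
Proof.
  intros Hf Hg. apply (Abs_Fn2 f g (fun O x y => x = y) Hf Hg).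
  exists (Eq (Var 2) (Var 3)). intros M a b r HM. simpl. split.
  - apply (value_inj M HM).
  - congruence.
Qed.

Lemma Abs_lt f g : Fn f -> Fn g -> Abs (fun O r => f r < g r).
Proof.
  intros Hf Hg. apply (Abs_Fn2 f g (fun O x y => x < y) Hf Hg).
  exists (Lt (Var 2) (Var 3)). intros M a b r HM. apply (value_lt M HM).
Qed.

Lemma Abs_oracle f g h k : Fn f -> Fn g -> Fn h -> Fn k ->
  Abs (fun O r => O (f r) (g r) (h r) (k r)).
Proof.
  intros Hf Hg Hh Hk.
  apply (Abs_Fn f (fun O x r => O x (g r) (h r) (k r)) Hf).
  apply (Abs_Fn _ (fun O x r => O (r 0) x (h (fun n => r (S n))) (k (fun n => r (S n)))) (Fn_ren S g Hg)).
  apply (Abs_Fn _ (fun O x r => O (r 1) (r 0) x (k (fun n => r (S (S n)))))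
           (Fn_ren (fun n => S (S n)) h Hh)).
  apply (Abs_Fn _ (fun O x r => O (r 2) (r 1) (r 0) x) (Fn_ren (fun n => S (S (S n))) k Hk)).
  cut (Abs (fun O r => O (r 0) (r 1) (r 2) (r 3))).
  { exact (Abs_ren (fun k => match k with 0 => 3 | 1 => 2 | 2 => 1 | _ => 0 end) _). }
  exists (subst (env6 (Var 0) (Var 1) (Var 2) (Var 3) (Var 4) (Var 5) Zero) w).
  intros M a b r HM. rewrite sat_subst. unfold orc. apply sat_ext.
  intros [|[|[|[|[|[|n]]]]]]; reflexivity.
Qed.

(** Below a standard bound all elements of a model of PA are standard, so quantifying over [M] and
    over [nat] amounts to the same. *)
Lemma Abs_ball f (P : oracle -> nat -> (nat -> nat) -> Prop) :
  Fn f -> Abs (fun O r => P O (r 0) (fun n => r (S n))) ->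
  Abs (fun O r => forall x, x < f r -> P O x r).
Proof.
  intros Hf [p Hp].
  apply (Abs_Fn f (fun O y r => forall x, x < y -> P O x r) Hf).
  (* The context is [x], [a], [b], the bound, then the other variables; the substitution moves [a]
     and [b] back to the front and drops the bound. *)
  exists (All (Imp (Lt (Var 0) (Var 3))
    (subst (scons (Var 1) (scons (Var 2) (scons (Var 0) (fun n => Var (S (S (S (S n)))))))) p))).
  intros M a b r HM. simpl. split.
  - intros H x Hx. specialize (H (value M x)). rewrite sat_subst in H.
    apply (Hp M a b (scons x (fun n => r (S n))) HM).
    eapply sat_ext; [|apply H, (value_lt M HM), Hx]. intros [|[|[|n]]]; reflexivity.
  - intros H x Hx. apply (lt_value M HM) in Hx. destruct Hx as [k [Hk ->]].
    rewrite sat_subst. specialize (H k Hk).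
    apply (Hp M a b (scons k (fun n => r (S n))) HM) in H.
    eapply sat_ext; [|exact H]. intros [|[|[|n]]]; reflexivity.
Qed.

Lemma Abs_bex f (P : oracle -> nat -> (nat -> nat) -> Prop) :
  Fn f -> Abs (fun O r => P O (r 0) (fun n => r (S n))) ->
  Abs (fun O r => exists x, x < f r /\ P O x r).
Proof.
  intros Hf HP. apply (Abs_iff (fun O r => ~ forall x, x < f r -> ~ P O x r)).
  - intros O r. split.
    + intros [x [Hx H]] K. exact (K x Hx H).
    + intros H. apply NNPP. intros K. apply H. intros x Hx H'. eauto.
  - apply Abs_not, (Abs_ball f (fun O x r => ~ P O x r)); auto. apply Abs_not, HP.
Qed.

Lemma Fn_cpair f g : Fn f -> Fn g -> Fn (fun r => cpair (f r) (g r)).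
Proof.
  apply Fn_op2. intros P H.
  apply (Abs_iff (fun O r => exists z, z < (r 1 + r 0 + 1) * (r 1 + r 0 + 1) /\
    (z + z = (r 1 + r 0) * (r 1 + r 0 + 1) + r 0 + r 0 /\ P O z (fun n => r (S (S n)))))).
  - intros O r. setoid_rewrite <- cpair_eq. split.
    + intros HP. exists (cpair (r 1) (r 0)). auto using cpair_bound.
    + intros [z [_ [-> HP]]]. exact HP.
  - apply (Abs_bex (fun r => (r 1 + r 0 + 1) * (r 1 + r 0 + 1))
       (fun O z r => z + z = (r 1 + r 0) * (r 1 + r 0 + 1) + r 0 + r 0 /\
          P O z (fun n => r (S (S n))))).
    + repeat first [apply Fn_mul | apply Fn_add | apply Fn_var | apply Fn_const].
    + apply Abs_and.
      * apply Abs_eq;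
        repeat first [apply Fn_mul | apply Fn_add | apply Fn_var | apply Fn_const].
      * exact (Abs_ren (fun k => match k with 0 => 0 | S k => S (S (S k)) end) _ H).
Qed.

End Absolute.

Ltac fn := cbv beta; repeat first
  [ apply Fn_var | apply Fn_const | apply Fn_cpair | apply Fn_S | apply Fn_add
  | apply Fn_mul ].
Ltac abs := cbv beta; repeat (cbv beta; first
  [ assumption
  | apply Abs_eq; [solve [fn]|solve [fn]]
  | apply Abs_lt; [solve [fn]|solve [fn]]
  | apply Abs_oracle; [solve [fn]|solve [fn]|solve [fn]|solve [fn]]
  | apply Abs_and | apply Abs_or | apply Abs_not
  | apply Abs_ball; [solve [fn]|]
  | apply Abs_bex; [solve [fn]|]
  | apply Abs_bot
  | apply Abs_imp ]).

(** * Sigma_1 relations and computability *)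

Section Enumerable.
Variable w : form.

(** A semantic version of Sigma_1: one unbounded witness over an absolute matrix. The matrix ignores
    the oracle, so it describes true facts about numbers only. *)
Definition Sig (P : (nat -> nat) -> Prop) : Prop :=
  exists R : nat -> (nat -> nat) -> Prop,
    Abs w (fun O r => R (r 0) (fun n => r (S n))) /\
    forall r, P r <-> exists n, R n r.

Lemma Sig_iff (P Q : (nat -> nat) -> Prop) : (forall r, Q r <-> P r) -> Sig P -> Sig Q.
Proof. intros H [R [HR E]]. exists R. split; auto. intros r. rewrite H; auto. Qed.

Lemma Sig_Abs (P : (nat -> nat) -> Prop) : Abs w (fun O r => P r) -> Sig P.
Proof.
  intros H. exists (fun n r => P r). split.
  - exact (Abs_ren w S _ H).
  - intros r. split; [exists 0; auto|intros [_ ?]; auto].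
Qed.

Lemma Sig_ex (P : nat -> (nat -> nat) -> Prop) :
  Sig (fun r => P (r 0) (fun n => r (S n))) -> Sig (fun r => exists x, P x r).
Proof.
  intros [R [HR E]].
  (* A common bound [m] replaces the two witnesses, which avoids decoding a pair. *)
  exists (fun m r => exists x, x < m /\ exists n, n < m /\ R n (scons x r)). split.
  - refine (Abs_bex w (fun r => r 0) (fun O x r => exists n, n < r 0 /\
      R n (scons x (fun k => r (S k)))) _ _); [fn|].
    refine (Abs_bex w (fun r => r 1) (fun O n r => R n (scons (r 0) (fun k => r (S (S k))))) _ _); [fn|].
    eapply Abs_iff; [|exact (Abs_ren w (fun k => match k with 0 => 0 | 1 => 1 | S (S k) => S (S (S k)) end) _ HR)].
    intros O r. cbv beta.
    replace (scons (r 1) (fun k => r (S (S (S k))))) with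
      (fun n => r match n with 0 => 1 | S k => S (S (S k)) end); [reflexivity|].
    apply functional_extensionality. intros [|n]; reflexivity.
  - intros r. split.
    + intros [x Hx]. specialize (E (scons x r)). simpl in E.
      destruct (proj1 E Hx) as [n Hn]. exists (S (x + n)). exists x. split; [lia|].
      exists n. split; [lia|exact Hn].
    + intros [m [x [_ [n [_ Hn]]]]]. exists x. apply (E (scons x r)). eauto.
Qed.

Lemma Sig_and (P Q : (nat -> nat) -> Prop) : Sig P -> Sig Q -> Sig (fun r => P r /\ Q r).
Proof.
  intros [R [HR E]] [R' [HR' E']].
  exists (fun m r => (exists n, n < m /\ R n r) /\ (exists n, n < m /\ R' n r)). split.
  - apply Abs_and.
    + refine (Abs_bex w (fun r => r 0) (fun O n r => R n (fun k => r (S k))) _ _); [fn|].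
      exact (Abs_ren w (fun k => match k with 0 => 0 | S k => S (S k) end) _ HR).
    + refine (Abs_bex w (fun r => r 0) (fun O n r => R' n (fun k => r (S k))) _ _); [fn|].
      exact (Abs_ren w (fun k => match k with 0 => 0 | S k => S (S k) end) _ HR').
  - intros r. rewrite E, E'. split.
    + intros [[n Hn] [m Hm]]. exists (S (n + m)). split; [exists n|exists m]; split; auto; lia.
    + intros [m [[n [_ Hn]] [n' [_ Hn']]]]. eauto.
Qed.

Lemma collection (P : nat -> nat -> Prop) b :
  (forall x, x < b -> exists n, P x n) ->
  exists m, forall x, x < b -> exists n, n < m /\ P x n.
Proof.
  induction b as [|b IH]; intros H.
  - exists 0. intros; lia.
  - destruct IH as [m Hm]; [auto|]. destruct (H b) as [k Hk]; [lia|].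
    exists (S (m + k)). intros x Hx. destruct (Nat.eq_dec x b) as [->|Hne].
    + exists k. split; auto; lia.
    + destruct (Hm x) as [n [Hn Hp]]; [lia|]. exists n. split; auto; lia.
Qed.

Lemma Sig_ball f (P : nat -> (nat -> nat) -> Prop) :
  Fn w f -> Sig (fun r => P (r 0) (fun n => r (S n))) ->
  Sig (fun r => forall x, x < f r -> P x r).
Proof.
  intros Hf [R [HR E]].
  exists (fun m r => forall x, x < f r -> exists n, n < m /\ R n (scons x r)). split.
  - refine (Abs_ball w (fun r => f (fun k => r (S k))) (fun O x r => exists n, n < r 0 /\
      R n (scons x (fun k => r (S k)))) _ _); [apply Fn_ren, Hf|].
    refine (Abs_bex w (fun r => r 1) (fun O n r => R n (scons (r 0) (fun k => r (S (S k))))) _ _); [fn|].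
    eapply Abs_iff; [|exact (Abs_ren w (fun k => match k with 0 => 0 | 1 => 1 | S (S k) => S (S (S k)) end) _ HR)].
    intros O r. cbv beta.
    replace (scons (r 1) (fun k => r (S (S (S k))))) with
      (fun n => r match n with 0 => 1 | S k => S (S (S k)) end); [reflexivity|].
    apply functional_extensionality. intros [|n]; reflexivity.
  - intros r. split.
    + intros H. apply (collection (fun x n => R n (scons x r))). intros x Hx.
      apply (E (scons x r)). exact (H x Hx).
    + intros [m H] x Hx. destruct (H x Hx) as [n [_ Hn]]. apply (E (scons x r)). eauto.
Qed.

Lemma Sig_Fn f (P : nat -> (nat -> nat) -> Prop) :
  Fn w f -> Sig (fun r => P (r 0) (fun n => r (S n))) -> Sig (fun r => P (f r) r).
Proof.
  intros Hf H. apply (Sig_iff (fun r => exists x, x = f r /\ P x r)).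
  - intros r. split; [eauto|intros [x [-> Hx]]; exact Hx].
  - apply Sig_ex. apply Sig_and; [|exact H]. apply Sig_Abs, Abs_eq; [fn|].
    apply Fn_ren, Hf.
Qed.

Lemma Sig_ren (s : nat -> nat) (P : (nat -> nat) -> Prop) :
  Sig P -> Sig (fun r => P (fun n => r (s n))).
Proof.
  intros [R [HR E]]. exists (fun n r => R n (fun k => r (s k))). split.
  - exact (Abs_ren w (fun k => match k with 0 => 0 | S k => S (s k) end) _ HR).
  - intros r. apply E.
Qed.

Lemma Sig_Fn2 f g (R : nat -> nat -> Prop) :
  Fn w f -> Fn w g -> Sig (fun r => R (r 0) (r 1)) -> Sig (fun r => R (f r) (g r)).
Proof.
  intros Hf Hg H. apply (Sig_Fn f (fun x r => R x (g r)) Hf).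
  apply (Sig_Fn _ (fun y r => R (r 0) y) (Fn_ren w S g Hg)).
  exact (Sig_ren (fun k => match k with 0 => 1 | _ => 0 end) _ H).
Qed.

Lemma std_beta a b i v : beta std a b i v <->
  v < (i + 1) * b + 1 /\ exists q, q < a + 1 /\ a = q * ((i + 1) * b + 1) + v.
Proof.
  unfold beta, modulus; simpl. split; intros [H [q Hq]]; split; auto; exists q.
  - split; auto. nia.
  - tauto.
Qed.

Lemma Sig_beta f g h k : Fn w f -> Fn w g -> Fn w h -> Fn w k ->
  Sig (fun r => beta std (f r) (g r) (h r) (k r)).
Proof.
  intros. apply Sig_Abs. eapply Abs_iff; [intros O r; apply std_beta|].
  apply Abs_and.
  - apply Abs_lt; [assumption|]. fn; assumption.
  - refine (Abs_bex w (fun r => f r + 1) (fun O q r => f r = q * ((h r + 1) * g r + 1) + k r) _ _).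
    + fn; assumption.
    + apply Abs_eq; fn; apply Fn_ren; assumption.
Qed.

Lemma prec_sequence (F : nat -> Prop) (G : nat -> nat -> nat -> Prop) n v :
  nat_rect (fun _ => nat -> Prop) F (fun m R x => exists u, R u /\ G m u x) n v <->
  exists s, F (s 0) /\ (forall m, m < n -> G m (s m) (s (S m))) /\ s n = v.
Proof.
  revert v. induction n as [|n IHn]; intros v; simpl.
  - split.
    + intros H. exists (fun _ => v). repeat split; auto. intros; lia.
    + intros [s [H [_ <-]]]; exact H.
  - split.
    + intros [u [Hu HG]]. apply IHn in Hu. destruct Hu as [s [H0 [H1 H2]]].
      exists (fun m => if m =? S n then v else s m). repeat split.
      * exact H0.
      * intros m Hm. destruct (Nat.eqb_spec m (S n)); [lia|].
        destruct (Nat.eqb_spec (S m) (S n)).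
        -- replace m with n by lia. rewrite H2. exact HG.
        -- apply H1. lia.
      * rewrite Nat.eqb_refl. reflexivity.
    + intros [s [H0 [H1 <-]]]. exists (s n). split; [|apply H1; lia].
      apply IHn. exists s. repeat split; auto.
Qed.

(** Gödel's elimination of primitive recursion: the course of values becomes a beta sequence, hence
    two number quantifiers. Conversely, uniqueness of beta values lets the local conditions be glued
    to one sequence. *)
Lemma prec_beta (F : nat -> Prop) (G : nat -> nat -> nat -> Prop) n v :
  nat_rect (fun _ => nat -> Prop) F (fun m R x => exists u, R u /\ G m u x) n v <->
  exists a b, (exists x, beta std a b 0 x /\ F x) /\
    (forall m, m < n -> exists x y, beta std a b m x /\ beta std a b (S m) y /\ G m x y) /\
    beta std a b n v.
Proof.
  rewrite prec_sequence. split.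
  - intros [s [H0 [H1 H2]]]. destruct (beta_sequence std std_PA (S n) s) as [a [b H]].
    assert (H' : forall j, j <= n -> beta std a b j (s j)).
    { intros j Hj. specialize (H j ltac:(lia)). rewrite std_value in H. exact H. }
    exists a, b. repeat split.
    + exists (s 0). split; auto. apply H'; lia.
    + intros m Hm. exists (s m), (s (S m)). repeat split; try apply H'; auto; lia.
    + rewrite <- H2. apply H'; lia.
    + rewrite <- H2. apply H'; lia.
  - intros [a [b [[x [Hx HF]] [HG Hv]]]].
    pose (s := fun m => epsilon (inhabits 0) (beta std a b m)).
    assert (Hs : forall m x, beta std a b m x -> s m = x).
    { intros m y Hy. eapply (beta_unique std std_PA); [|exact Hy].
      apply (epsilon_spec (inhabits 0)). eauto. }
    exists s. repeat split.
    + rewrite (Hs 0 x); auto.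
    + intros m Hm. destruct (HG m Hm) as [y [z [Hy [Hz H]]]].
      rewrite (Hs m y), (Hs (S m) z); auto.
    + apply Hs, Hv.
Qed.

Lemma Sig_computes c : Sig (fun r => computes c (r 0) (r 1)).
Proof.
  induction c.
  - apply Sig_Abs. simpl. abs.
  - apply Sig_Abs. simpl. abs.
  - apply (Sig_iff (fun r => exists y, r 0 = cpair (r 1) y)).
    + intros r. simpl. split.
      * intros ->. exists (cright (r 0)). symmetry; apply cpair_surj.
      * intros [y ->]. rewrite cleft_cpair. reflexivity.
    + apply Sig_ex, Sig_Abs. abs.
  - apply (Sig_iff (fun r => exists x, r 0 = cpair x (r 1))).
    + intros r. simpl. split.
      * intros ->. exists (cleft (r 0)). symmetry; apply cpair_surj.
      * intros [y ->]. rewrite cright_cpair. reflexivity.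
    + apply Sig_ex, Sig_Abs. abs.
  - simpl. apply Sig_ex, Sig_ex, Sig_and; [|apply Sig_and].
    + apply (Sig_Fn2 (fun r => r 2) (fun r => r 1)); [fn|fn|exact IHc1].
    + apply (Sig_Fn2 (fun r => r 2) (fun r => r 0)); [fn|fn|exact IHc2].
    + apply Sig_Abs. abs.
  - simpl. apply Sig_ex, Sig_and.
    + apply (Sig_Fn2 (fun r => r 1) (fun r => r 0)); [fn|fn|exact IHc2].
    + apply (Sig_Fn2 (fun r => r 0) (fun r => r 2)); [fn|fn|exact IHc1].
  - apply (Sig_iff (fun r => exists p q, r 0 = cpair p q /\ exists a b,
       (exists x, beta std a b 0 x /\ computes c1 p x) /\
       (forall m, m < q -> exists x y, beta std a b m x /\ beta std a b (S m) y /\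
          computes c2 (cpair p (cpair m x)) y) /\
       beta std a b q (r 1))).
    + intros r. cbn [computes].
      rewrite (prec_beta (computes c1 (cleft (r 0)))
        (fun m u x => computes c2 (cpair (cleft (r 0)) (cpair m u)) x)). split.
      * intros H. exists (cleft (r 0)), (cright (r 0)). rewrite cpair_surj. auto.
      * intros [p [q [-> H]]]. rewrite cleft_cpair, cright_cpair. exact H.
    + apply Sig_ex, Sig_ex, Sig_and; [apply Sig_Abs; abs|].
      apply Sig_ex, Sig_ex, Sig_and; [|apply Sig_and].
      * apply Sig_ex, Sig_and; [apply Sig_beta; fn|].
        apply (Sig_Fn2 (fun r => r 4) (fun r => r 0)); [fn|fn|exact IHc1].
      * apply Sig_ball; [fn|]. apply Sig_ex, Sig_ex, Sig_and; [apply Sig_beta; fn|].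
        apply Sig_and; [apply Sig_beta; fn|].
        apply (Sig_Fn2 (fun r => cpair (r 6) (cpair (r 2) (r 1))) (fun r => r 0));
          [fn|fn|exact IHc2].
      * apply Sig_beta; fn.
  - simpl. apply Sig_and.
    + apply (Sig_Fn2 (fun r => cpair (r 0) (r 1)) (fun r => 0)); [fn|fn|exact IHc].
    + apply Sig_ball; [fn|]. apply Sig_ex.
      apply (Sig_Fn2 (fun r => cpair (r 2) (r 1)) (fun r => S (r 0))); [fn|fn|exact IHc].
Qed.

(** The relation [R] enumerates the axioms in stages. Searching only for [k] below a bound gives
    absolute approximations from below to the possibly undecidable set of axioms. *)
Lemma Sig_codes (A : theory) : ce_theory A ->
  exists R : nat -> nat -> Prop, Abs w (fun O r => R (r 0) (r 1)) /\
    forall n, (exists p, A p /\ code p = n) <-> exists k, R k n.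
Proof.
  intros [c Hc].
  assert (H : Sig (fun r => exists v, computes c (r 0) v)).
  { apply Sig_ex. apply (Sig_Fn2 (fun r => r 1) (fun r => r 0)); [fn|fn|apply Sig_computes]. }
  destruct H as [R [HR E]].
  exists (fun k n => R k (fun _ => n)). split.
  - exact (Abs_ren w (fun k => match k with 0 => 0 | _ => 1 end) _ HR).
  - intros n. rewrite Hc. exact (E (fun _ => n)).
Qed.

End Enumerable.

(** * Henkin truth assignments *)

Opaque cpair.

Lemma cleft_le n : cleft n <= n.
Proof. rewrite <- (cpair_surj n) at 2. pose proof (cpair_ge (cleft n) (cright n)). lia. Qed.

Lemma cright_le n : cright n <= n.
Proof. rewrite <- (cpair_surj n) at 2. pose proof (cpair_ge (cleft n) (cright n)). lia. Qed.

Lemma cright_lt n : 1 <= cleft n -> cright n < n.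
Proof. rewrite <- (cpair_surj n) at 3. pose proof (cpair_ge (cleft n) (cright n)). lia. Qed.

(** Subcodes are smaller numbers rather than structural subterms, hence the fuel [k]. Numbers that
    code no term decode to an arbitrary one, so the decoding is total. *)
Fixpoint tdecf (k n : nat) : term :=
  match k with
  | 0 => Zero
  | S k =>
    match cleft n with
    | 0 => Var (cright n)
    | 1 => Zero
    | 2 => One
    | 3 => Add (tdecf k (cleft (cright n))) (tdecf k (cright (cright n)))
    | 4 => Mul (tdecf k (cleft (cright n))) (tdecf k (cright (cright n)))
    | _ => Zero
    end
  end.

Definition tdec (n : nat) : term := tdecf (S n) n.

Lemma tdecf_fuel k : forall k' n, n < k -> n < k' -> tdecf k n = tdecf k' n.
Proof.
  induction k as [|k IH]; intros [|k'] n H H'; try lia. simpl.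
  pose proof (cleft_le (cright n)). pose proof (cright_le (cright n)).
  pose proof (cright_lt n).
  destruct (cleft n) as [|[|[|[|[|m]]]]]; auto; f_equal; apply IH; lia.
Qed.

Lemma tdec_eq n : tdec n =
  match cleft n with
  | 0 => Var (cright n)
  | 1 => Zero
  | 2 => One
  | 3 => Add (tdec (cleft (cright n))) (tdec (cright (cright n)))
  | 4 => Mul (tdec (cleft (cright n))) (tdec (cright (cright n)))
  | _ => Zero
  end.
Proof.
  unfold tdec at 1. cbn [tdecf].
  pose proof (cleft_le (cright n)). pose proof (cright_le (cright n)).
  pose proof (cright_lt n).
  destruct (cleft n) as [|[|[|[|[|m]]]]]; auto; f_equal; apply tdecf_fuel; lia.
Qed.

Fixpoint decf (k n : nat) : form :=
  match k with
  | 0 => Bot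
  | S k =>
    match cleft n with
    | 0 => Eq (tdec (cleft (cright n))) (tdec (cright (cright n)))
    | 1 => Lt (tdec (cleft (cright n))) (tdec (cright (cright n)))
    | 3 => Imp (decf k (cleft (cright n))) (decf k (cright (cright n)))
    | 4 => All (decf k (cright n))
    | _ => Bot
    end
  end.

Definition dec (n : nat) : form := decf (S n) n.

Lemma decf_fuel k : forall k' n, n < k -> n < k' -> decf k n = decf k' n.
Proof.
  induction k as [|k IH]; intros [|k'] n H H'; try lia. simpl.
  pose proof (cleft_le (cright n)). pose proof (cright_le (cright n)).
  pose proof (cright_lt n).
  destruct (cleft n) as [|[|[|[|[|m]]]]]; auto; f_equal; apply IH; lia.
Qed.

Lemma dec_eq n : dec n =
  match cleft n with
  | 0 => Eq (tdec (cleft (cright n))) (tdec (cright (cright n)))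
  | 1 => Lt (tdec (cleft (cright n))) (tdec (cright (cright n)))
  | 3 => Imp (dec (cleft (cright n))) (dec (cright (cright n)))
  | 4 => All (dec (cright n))
  | _ => Bot
  end.
Proof.
  unfold dec at 1. cbn [decf].
  pose proof (cleft_le (cright n)). pose proof (cright_le (cright n)).
  pose proof (cright_lt n).
  destruct (cleft n) as [|[|[|[|[|m]]]]]; auto; f_equal; apply decf_fuel; lia.
Qed.

Arguments tdec : simpl never.
Arguments dec : simpl never.
Ltac decode := repeat (rewrite cleft_cpair || rewrite cright_cpair); simpl.

Lemma tdec_tcode t : tdec (tcode t) = t.
Proof. induction t; rewrite tdec_eq; simpl; decode; congruence. Qed.

Lemma dec_code p : dec (code p) = p.
Proof.
  induction p; rewrite dec_eq; simpl; decode; rewrite ?tdec_tcode; congruence.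
Qed.

(** A number [r] also codes an environment, whose first entry is [cleft r]. *)
Fixpoint env (r n : nat) : nat :=
  match n with 0 => cleft r | S m => env (cright r) m end.

Lemma env_cpair x r : env (cpair x r) = scons x (env r).
Proof.
  apply functional_extensionality. intros [|n]; simpl; decode; reflexivity.
Qed.

Lemma env_le n : forall r, env r n <= r.
Proof.
  induction n; intros r; simpl; [apply cleft_le|].
  specialize (IHn (cright r)). pose proof (cright_le r). lia.
Qed.

(** Names of the elements of a countable structure: [cst i] are the constants,
    [wit p r] is a counterexample to [All p] in the environment [r] of names if
    there is one, and [val t r] is the value of the term [t] in [r]. *)
Definition cst (i : nat) : nat := cpair 0 i.
Definition wit (p r : nat) : nat := cpair 1 (cpair p r).
Definition val (t r : nat) : nat := cpair 2 (cpair t r).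

Definition env2 (x y : nat) : nat := cpair x (cpair y 0).
Definition env3 (x y z : nat) : nat := cpair x (cpair y (cpair z 0)).

Definition eqn (x y : nat) : nat := cpair (code (Eq (Var 0) (Var 1))) (env2 x y).
Definition ltn (x y : nat) : nat := cpair (code (Lt (Var 0) (Var 1))) (env2 x y).
Definition addn (x y : nat) : nat := val (tcode (Add (Var 0) (Var 1))) (env2 x y).
Definition muln (x y : nat) : nat := val (tcode (Mul (Var 0) (Var 1))) (env2 x y).

(** [X (cpair p r)] is to be read as: the formula coded by [p] holds in the
    environment coded by [r]. *)
Record henkin (X : nat -> Prop) : Prop := {
  hk_refl : forall x, X (eqn x x);
  hk_euclid : forall x y z, X (eqn x y) -> X (eqn z y) -> X (eqn x z);
  hk_add : forall x y x' y', X (eqn x x') -> X (eqn y y') -> X (eqn (addn x y) (addn x' y'));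
  hk_mul : forall x y x' y', X (eqn x x') -> X (eqn y y') -> X (eqn (muln x y) (muln x' y'));
  hk_ltn : forall x y x' y', X (eqn x x') -> X (eqn y y') -> X (ltn x y) -> X (ltn x' y');
  hk_var0 : forall x r, X (eqn (val (cpair 0 0) (cpair x r)) x);
  hk_varS : forall n x r,
    X (eqn (val (cpair 0 (S n)) (cpair x r)) (val (cpair 0 n) r));
  hk_zero : forall r, X (eqn (val (cpair 1 0) r) (val (cpair 1 0) 0));
  hk_one : forall r, X (eqn (val (cpair 2 0) r) (val (cpair 2 0) 0));
  hk_tadd : forall a b r,
    X (eqn (val (cpair 3 (cpair a b)) r) (addn (val a r) (val b r)));
  hk_tmul : forall a b r,
    X (eqn (val (cpair 4 (cpair a b)) r) (muln (val a r) (val b r)));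
  hk_eq1 : forall a b r,
    X (cpair (cpair 0 (cpair a b)) r) -> X (eqn (val a r) (val b r));
  hk_eq2 : forall a b r,
    X (eqn (val a r) (val b r)) -> X (cpair (cpair 0 (cpair a b)) r);
  hk_lt1 : forall a b r,
    X (cpair (cpair 1 (cpair a b)) r) -> X (ltn (val a r) (val b r));
  hk_lt2 : forall a b r,
    X (ltn (val a r) (val b r)) -> X (cpair (cpair 1 (cpair a b)) r);
  hk_bot : forall r, ~ X (cpair (cpair 2 0) r);
  hk_imp1 : forall p q r,
    X (cpair (cpair 3 (cpair p q)) r) -> X (cpair p r) -> X (cpair q r);
  hk_imp2 : forall p q r, X (cpair p r) \/ X (cpair (cpair 3 (cpair p q)) r);
  hk_imp3 : forall p q r, X (cpair q r) -> X (cpair (cpair 3 (cpair p q)) r);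
  hk_all1 : forall p x r, X (cpair (cpair 4 p) r) -> X (cpair p (cpair x r));
  hk_all2 : forall p r, X (cpair p (cpair (wit p r) r)) -> X (cpair (cpair 4 p) r)
}.

Definition literal : Type := (bool * ((nat -> nat) -> nat))%type.

Definition neg (f : (nat -> nat) -> nat) : literal := (false, f).
Definition pos (f : (nat -> nat) -> nat) : literal := (true, f).

(** These are the fields of [henkin] in the same order, as disjunctions of literals. Every instance
    touches finitely many bits, so failure to be a Henkin assignment shows at a finite stage. *)
Definition henkin_clauses : list (list literal) :=
  (pos (fun r => eqn (r 0) (r 0)) :: nil) ::
  (neg (fun r => eqn (r 0) (r 1)) :: neg (fun r => eqn (r 2) (r 1)) ::
   pos (fun r => eqn (r 0) (r 2)) :: nil) ::
  (neg (fun r => eqn (r 0) (r 2)) :: neg (fun r => eqn (r 1) (r 3)) ::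
   pos (fun r => eqn (addn (r 0) (r 1)) (addn (r 2) (r 3))) :: nil) ::
  (neg (fun r => eqn (r 0) (r 2)) :: neg (fun r => eqn (r 1) (r 3)) ::
   pos (fun r => eqn (muln (r 0) (r 1)) (muln (r 2) (r 3))) :: nil) ::
  (neg (fun r => eqn (r 0) (r 2)) :: neg (fun r => eqn (r 1) (r 3)) ::
   neg (fun r => ltn (r 0) (r 1)) :: pos (fun r => ltn (r 2) (r 3)) :: nil) ::
  (pos (fun r => eqn (val (cpair 0 0) (cpair (r 0) (r 1))) (r 0)) :: nil) ::
  (pos (fun r => eqn (val (cpair 0 (S (r 0))) (cpair (r 1) (r 2)))
                     (val (cpair 0 (r 0)) (r 2))) :: nil) ::
  (pos (fun r => eqn (val (cpair 1 0) (r 0)) (val (cpair 1 0) 0)) :: nil) ::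
  (pos (fun r => eqn (val (cpair 2 0) (r 0)) (val (cpair 2 0) 0)) :: nil) ::
  (pos (fun r => eqn (val (cpair 3 (cpair (r 0) (r 1))) (r 2))
                     (addn (val (r 0) (r 2)) (val (r 1) (r 2)))) :: nil) ::
  (pos (fun r => eqn (val (cpair 4 (cpair (r 0) (r 1))) (r 2))
                     (muln (val (r 0) (r 2)) (val (r 1) (r 2)))) :: nil) ::
  (neg (fun r => cpair (cpair 0 (cpair (r 0) (r 1))) (r 2)) ::
   pos (fun r => eqn (val (r 0) (r 2)) (val (r 1) (r 2))) :: nil) ::
  (pos (fun r => cpair (cpair 0 (cpair (r 0) (r 1))) (r 2)) ::
   neg (fun r => eqn (val (r 0) (r 2)) (val (r 1) (r 2))) :: nil) ::
  (neg (fun r => cpair (cpair 1 (cpair (r 0) (r 1))) (r 2)) ::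
   pos (fun r => ltn (val (r 0) (r 2)) (val (r 1) (r 2))) :: nil) ::
  (pos (fun r => cpair (cpair 1 (cpair (r 0) (r 1))) (r 2)) ::
   neg (fun r => ltn (val (r 0) (r 2)) (val (r 1) (r 2))) :: nil) ::
  (neg (fun r => cpair (cpair 2 0) (r 0)) :: nil) ::
  (neg (fun r => cpair (cpair 3 (cpair (r 0) (r 1))) (r 2)) ::
   neg (fun r => cpair (r 0) (r 2)) :: pos (fun r => cpair (r 1) (r 2)) :: nil) ::
  (pos (fun r => cpair (r 0) (r 2)) ::
   pos (fun r => cpair (cpair 3 (cpair (r 0) (r 1))) (r 2)) :: nil) ::
  (neg (fun r => cpair (r 1) (r 2)) ::
   pos (fun r => cpair (cpair 3 (cpair (r 0) (r 1))) (r 2)) :: nil) ::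
  (neg (fun r => cpair (cpair 4 (r 0)) (r 2)) ::
   pos (fun r => cpair (r 0) (cpair (r 1) (r 2))) :: nil) ::
  (neg (fun r => cpair (r 0) (cpair (wit (r 0) (r 2)) (r 2))) ::
   pos (fun r => cpair (cpair 4 (r 0)) (r 2)) :: nil) :: nil.

(** Three-valued violation: [P] lists the bits known to be true, [Q] those
    known to be false. *)
Fixpoint falsified (P Q : nat -> Prop) (r : nat -> nat) (cl : list literal) : Prop :=
  match cl with
  | nil => True
  | cons (b, f) cl => (if b : bool then Q (f r) else P (f r)) /\ falsified P Q r cl
  end.

Fixpoint violates (P Q : nat -> Prop) (r : nat -> nat) (cls : list (list literal)) : Prop :=
  match cls with
  | nil => False
  | cons cl cls => falsified P Q r cl \/ violates P Q r cls
  end.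

Lemma falsified_mono (P Q P' Q' : nat -> Prop) r cl :
  (forall i, P i -> P' i) -> (forall i, Q i -> Q' i) ->
  falsified P Q r cl -> falsified P' Q' r cl.
Proof.
  intros HP HQ. induction cl as [|[[|] f] cl IH]; simpl; auto; intros []; split; auto.
Qed.

Lemma violates_mono (P Q P' Q' : nat -> Prop) r cls :
  (forall i, P i -> P' i) -> (forall i, Q i -> Q' i) ->
  violates P Q r cls -> violates P' Q' r cls.
Proof.
  intros HP HQ. induction cls as [|cl cls IH]; simpl; auto. intros [H|H]; auto.
  left; eapply falsified_mono; eauto.
Qed.

(** With true and false bits in separate predicates, a violation is a finite conjunction and
    disjunction of positive statements, and a filter commutes with these in the required
    direction. *)
Lemma violates_ultra (I : Type) U (HU : ultrafilter I U) (P Q : I -> nat -> Prop) r cls :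
  violates (fun i => U (fun x => P x i)) (fun i => U (fun x => Q x i)) r cls ->
  U (fun x => violates (P x) (Q x) r cls).
Proof.
  assert (K : forall cl,
    falsified (fun i => U (fun x => P x i)) (fun i => U (fun x => Q x i)) r cl ->
    U (fun x => falsified (P x) (Q x) r cl)).
  { induction cl as [|[[|] f] cl IH]; simpl.
    - intros _. apply uf_all; auto.
    - intros [H1 H2]. apply (uf_and I U HU); auto.
    - intros [H1 H2]. apply (uf_and I U HU); auto. }
  induction cls as [|cl cls IH]; simpl; [tauto|].
  intros [H|H]; [apply K in H; revert H|apply IH in H; revert H];
    apply (uf_mono I U HU); auto.
Qed.

Lemma henkin_violates X :
  henkin X <-> forall r, ~ violates X (fun i => ~ X i) r henkin_clauses.
Proof.
  split.
  - intros HX r. cbn.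
    intros V; repeat match goal with
      | K : _ \/ _ |- _ => destruct K | K : _ /\ _ |- _ => destruct K end;
      try (destruct HX; eauto 6; fail).
    + eapply (hk_bot X HX); eassumption.
    + destruct (hk_imp2 X HX (r 0) (r 1) (r 2)); auto.
  - intros H.
    (* No clause looks beyond the first four entries of the instance; the rest is padded with 0. *)
    assert (K : forall v w x y, ~ violates X (fun i => ~ X i)
      (scons v (scons w (scons x (scons y (fun _ => 0))))) henkin_clauses)
      by (intros; apply H).
    clear H. cbn in K. constructor.
    + intros x. specialize (K x 0 0 0). apply NNPP. tauto.
    + intros x y z. specialize (K x y z 0). intros; apply NNPP. tauto.
    + intros x y x' y'. specialize (K x y x' y'). intros; apply NNPP. tauto.
    + intros x y x' y'. specialize (K x y x' y'). intros; apply NNPP. tauto.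
    + intros x y x' y'. specialize (K x y x' y'). intros; apply NNPP. tauto.
    + intros x r. specialize (K x r 0 0). intros; apply NNPP. tauto.
    + intros n x r. specialize (K n x r 0). intros; apply NNPP. tauto.
    + intros r. specialize (K r 0 0 0). intros; apply NNPP. tauto.
    + intros r. specialize (K r 0 0 0). intros; apply NNPP. tauto.
    + intros a b r. specialize (K a b r 0). intros; apply NNPP. tauto.
    + intros a b r. specialize (K a b r 0). intros; apply NNPP. tauto.
    + intros a b r. specialize (K a b r 0). intros; apply NNPP. tauto.
    + intros a b r. specialize (K a b r 0). intros; apply NNPP. tauto.
    + intros a b r. specialize (K a b r 0). intros; apply NNPP. tauto.
    + intros a b r. specialize (K a b r 0). intros; apply NNPP. tauto.
    + intros r. specialize (K r 0 0 0). tauto.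
    + intros a b r. specialize (K a b r 0). intros; apply NNPP. tauto.
    + intros a b r. specialize (K a b r 0). intros; apply NNPP. tauto.
    + intros a b r. specialize (K a b r 0). intros; apply NNPP. tauto.
    + intros p x r. specialize (K p x r 0). intros; apply NNPP. tauto.
    + intros p r. specialize (K p 0 r 0). intros; apply NNPP. tauto.
Qed.

(** * Henkin assignments and structures *)

Section Term_model.
Variable X : nat -> Prop.
Hypothesis HX : henkin X.

Let E (x y : nat) : Prop := X (eqn x y).
Let E_refl := hk_refl X HX : forall x, E x x.
Let E_euclid := hk_euclid X HX : forall x y z, E x y -> E z y -> E x z.
Let c (x : nat) := cls nat E x.
Let u (a : quot nat E) := repr nat E a.

Definition term_model : structure :=
  Structure (c (val (cpair 1 0) 0)) (c (val (cpair 2 0) 0))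
    (fun a b => c (addn (u a) (u b))) (fun a b => c (muln (u a) (u b)))
    (fun a b => X (ltn (u a) (u b))).

Lemma class_eq x y : c x = c y <-> E x y.
Proof. apply cls_eq; assumption. Qed.

Lemma class_var n : forall r, c (val (cpair 0 n) r) = c (env r n).
Proof.
  induction n; intros r; rewrite <- (cpair_surj r) at 1.
  - apply class_eq, (hk_var0 X HX).
  - rewrite (proj2 (class_eq _ _) (hk_varS X HX n _ _)). apply IHn.
Qed.

Lemma class_repr x : E x (u (c x)).
Proof. apply repr_cls, E_refl. Qed.

Lemma class_sym x y : E x y -> E y x.
Proof. intros; eapply E_euclid; eauto. Qed.

Lemma term_model_eval t r :
  teval term_model (fun n => c (env r n)) t = c (val (tcode t) r).
Proof.
  induction t; simpl.
  - symmetry; apply class_var.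
  - symmetry; apply class_eq, (hk_zero X HX).
  - symmetry; apply class_eq, (hk_one X HX).
  - rewrite IHt1, IHt2. transitivity (c (addn (val (tcode t1) r) (val (tcode t2) r))).
    + apply class_eq, (hk_add X HX); apply class_sym, class_repr.
    + symmetry. apply class_eq, (hk_tadd X HX).
  - rewrite IHt1, IHt2. transitivity (c (muln (val (tcode t1) r) (val (tcode t2) r))).
    + apply class_eq, (hk_mul X HX); apply class_sym, class_repr.
    + symmetry. apply class_eq, (hk_tmul X HX).
Qed.

Lemma term_model_sat p : forall r,
  sat term_model (fun n => c (env r n)) p <-> X (cpair (code p) r).
Proof.
  induction p; intros r; simpl.
  - rewrite !term_model_eval, class_eq. split; [apply (hk_eq2 X HX)|apply (hk_eq1 X HX)].
  - rewrite !term_model_eval. split.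
    + intros H. apply (hk_lt2 X HX). eapply (hk_ltn X HX); [| |exact H];
        apply class_sym, class_repr.
    + intros H. apply (hk_lt1 X HX) in H.
      eapply (hk_ltn X HX); [| |exact H]; apply class_repr.
  - split; [tauto|]. apply (hk_bot X HX).
  - rewrite IHp1, IHp2. split.
    + intros H. destruct (hk_imp2 X HX (code p1) (code p2) r) as [H1|H1]; auto.
      apply (hk_imp3 X HX); auto.
    + apply (hk_imp1 X HX).
  - assert (K : forall x, sat term_model (scons (c x) (fun n => c (env r n))) p <->
                X (cpair (code p) (cpair x r))).
    { intros x. rewrite <- IHp. rewrite env_cpair. apply sat_ext.
      intros [|n]; reflexivity. }
    split.
    (* The name [wit] denotes an element of the term model, so a universal formula true in the model
       holds at its own possible counterexample. *)
    + intros H. apply (hk_all2 X HX). apply K, H.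
    + intros H a. destruct (cls_surj _ _ a) as [x ->]. apply K.
      apply (hk_all1 X HX), H.
Qed.

End Term_model.

Theorem henkin_structure X : henkin X ->
  exists (N : structure) (q : nat -> N), (forall a, exists x, a = q x) /\
    forall p r, sat N (fun n => q (env r n)) p <-> X (cpair (code p) r).
Proof.
  intros HX. exists (term_model X), (cls nat (fun x y => X (eqn x y))). split.
  - apply cls_surj.
  - intros p r. apply (term_model_sat X HX).
Qed.

Section Assignment.
Variables (N : structure) (v : nat -> N).

Definition counterexample (q : form) (r : nat -> N) : N :=
  epsilon (inhabits (v 0)) (fun x => ~ sat N (scons x r) q).

(** The recursion goes through the entries of an environment, which are bounded by its code and thus
    smaller than the name built on it. *)
Fixpoint namef (k n : nat) : N :=
  match k with
  | 0 => v 0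
  | S k =>
    let r := fun m => namef k (env (cright (cright n)) m) in
    match cleft n with
    | 0 => v (cright n)
    | 1 => counterexample (dec (cleft (cright n))) r
    | _ => teval N r (tdec (cleft (cright n)))
    end
  end.

Definition name (n : nat) : N := namef (S n) n.

Lemma namef_fuel k : forall k' n, n < k -> n < k' -> namef k n = namef k' n.
Proof.
  induction k as [|k IH]; intros [|k'] n H H'; try lia. simpl.
  pose proof (cright_le (cright n)). pose proof (cright_lt n).
  assert (E : 1 <= cleft n -> (fun m => namef k (env (cright (cright n)) m)) =
                (fun m => namef k' (env (cright (cright n)) m))).
  { intros L. apply functional_extensionality. intros m.
    pose proof (env_le m (cright (cright n))). apply IH; lia. }
  destruct (cleft n) as [|[|m]]; auto; rewrite E; auto; lia.
Qed.

Lemma name_eq n : name n =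
  match cleft n with
  | 0 => v (cright n)
  | 1 => counterexample (dec (cleft (cright n))) (fun m => name (env (cright (cright n)) m))
  | _ => teval N (fun m => name (env (cright (cright n)) m)) (tdec (cleft (cright n)))
  end.
Proof.
  unfold name at 1. cbn [namef].
  pose proof (cright_le (cright n)). pose proof (cright_lt n).
  assert (E : 1 <= cleft n -> (fun m => namef n (env (cright (cright n)) m)) =
                (fun m => name (env (cright (cright n)) m))).
  { intros L. apply functional_extensionality. intros m.
    pose proof (env_le m (cright (cright n))). apply namef_fuel; lia. }
  destruct (cleft n) as [|[|m]]; auto; cbv zeta; rewrite E; auto; lia.
Qed.

Definition nenv (r : nat) : nat -> N := fun m => name (env r m).

Lemma name_cst i : name (cst i) = v i.
Proof. unfold cst. rewrite name_eq. decode. reflexivity. Qed.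

Lemma name_wit p r : name (wit p r) = counterexample (dec p) (nenv r).
Proof. unfold wit. rewrite name_eq. decode. reflexivity. Qed.

Lemma name_val t r : name (val t r) = teval N (nenv r) (tdec t).
Proof. unfold val. rewrite name_eq. decode. reflexivity. Qed.

Lemma nenv_cpair x r : nenv (cpair x r) = scons (name x) (nenv r).
Proof.
  unfold nenv. rewrite env_cpair. apply functional_extensionality. intros [|n]; reflexivity.
Qed.

Definition assignment (i : nat) : Prop := sat N (nenv (cright i)) (dec (cleft i)).

Lemma assignment_cpair p r : assignment (cpair p r) = sat N (nenv r) (dec p).
Proof. unfold assignment. decode. reflexivity. Qed.

Lemma assignment_eqn x y : assignment (eqn x y) = (name x = name y).
Proof.
  unfold eqn, env2. rewrite assignment_cpair, dec_code, !nenv_cpair. reflexivity.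
Qed.

Lemma assignment_ltn x y : assignment (ltn x y) = s_lt N (name x) (name y).
Proof.
  unfold ltn, env2. rewrite assignment_cpair, dec_code, !nenv_cpair. reflexivity.
Qed.

Lemma name_addn x y : name (addn x y) = s_add N (name x) (name y).
Proof.
  unfold addn, env2. rewrite name_val, tdec_tcode, !nenv_cpair. reflexivity.
Qed.

Lemma name_muln x y : name (muln x y) = s_mul N (name x) (name y).
Proof.
  unfold muln, env2. rewrite name_val, tdec_tcode, !nenv_cpair. reflexivity.
Qed.

Ltac unname := rewrite ?assignment_eqn, ?assignment_ltn, ?assignment_cpair,
  ?name_addn, ?name_muln, ?name_val, ?name_wit, ?nenv_cpair.
Ltac dec1 := match goal with |- context[dec (cpair ?a ?b)] => rewrite (dec_eq (cpair a b)) end; decode.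
Ltac tdec1 := match goal with |- context[tdec (cpair ?a ?b)] => rewrite (tdec_eq (cpair a b)) end; decode.

(** Truth is taken in all of [N], and [wit] denotes a counterexample chosen in [N] whenever there is
    one. Hence the quantifier clauses hold although the names reach only countably many elements. *)
Lemma assignment_henkin : henkin assignment.
Proof.
  constructor; intros *; unname; try dec1; try tdec1; unname; try congruence; try tauto.
  - rewrite tdec_eq. decode. reflexivity.
  - intros H. apply H.
  - intros H x. apply NNPP. intros Hx. revert H.
    apply (epsilon_spec (inhabits (v 0)) (fun x => ~ sat N (scons x (nenv r)) (dec p))).
    eauto.
Qed.

End Assignment.

Section Henkin_absolute.
Variable w : form.

Lemma Fn_val f g : Fn w f -> Fn w g -> Fn w (fun r => val (f r) (g r)).
Proof. intros; unfold val; fn; assumption. Qed.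
Lemma Fn_wit f g : Fn w f -> Fn w g -> Fn w (fun r => wit (f r) (g r)).
Proof. intros; unfold wit; fn; assumption. Qed.
Lemma Fn_cst f : Fn w f -> Fn w (fun r => cst (f r)).
Proof. intros; unfold cst; fn; assumption. Qed.
Lemma Fn_env2 f g : Fn w f -> Fn w g -> Fn w (fun r => env2 (f r) (g r)).
Proof. intros; unfold env2; fn; assumption. Qed.
Lemma Fn_env3 f g h : Fn w f -> Fn w g -> Fn w h -> Fn w (fun r => env3 (f r) (g r) (h r)).
Proof. intros; unfold env3; fn; assumption. Qed.
Lemma Fn_eqn f g : Fn w f -> Fn w g -> Fn w (fun r => eqn (f r) (g r)).
Proof. intros; apply Fn_cpair; [apply Fn_const|apply Fn_env2; assumption]. Qed.
Lemma Fn_ltn f g : Fn w f -> Fn w g -> Fn w (fun r => ltn (f r) (g r)).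
Proof. intros; apply Fn_cpair; [apply Fn_const|apply Fn_env2; assumption]. Qed.
Lemma Fn_addn f g : Fn w f -> Fn w g -> Fn w (fun r => addn (f r) (g r)).
Proof. intros; apply Fn_val; [apply Fn_const|apply Fn_env2; assumption]. Qed.
Lemma Fn_muln f g : Fn w f -> Fn w g -> Fn w (fun r => muln (f r) (g r)).
Proof. intros; apply Fn_val; [apply Fn_const|apply Fn_env2; assumption]. Qed.

Lemma Fn_henkin_clauses : Forall (Forall (fun l => Fn w (snd l))) henkin_clauses.
Proof.
  unfold henkin_clauses. repeat apply Forall_cons; try apply Forall_nil; cbn [snd pos neg];
  repeat first [ apply Fn_eqn | apply Fn_ltn | apply Fn_addn | apply Fn_muln
    | apply Fn_wit | apply Fn_val | apply Fn_var | apply Fn_const | apply Fn_cpair | apply Fn_S ].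
Qed.

Lemma Abs_violates (P Q : oracle -> (nat -> nat) -> nat -> Prop) (s : nat -> nat) cls :
  (forall f, Fn w f -> Abs w (fun O r => P O r (f r))) ->
  (forall f, Fn w f -> Abs w (fun O r => Q O r (f r))) ->
  Forall (Forall (fun l => Fn w (snd l))) cls ->
  Abs w (fun O r => violates (P O r) (Q O r) (fun k => r (s k)) cls).
Proof.
  intros HP HQ H. induction H as [|cl cls Hcl _ IH]; simpl; [apply Abs_bot|].
  apply Abs_or; [clear IH|exact IH].
  induction Hcl as [|[b f] cl Hf _ IH]; simpl.
  - apply (Abs_iff w (fun O r => ~ False)); [tauto|]. apply Abs_not, Abs_bot.
  - apply Abs_and; [|exact IH]. destruct b; [apply HQ|apply HP]; apply Fn_ren, Hf.
Qed.

End Henkin_absolute.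

(** * Stagewise refutation *)

Definition fadd (i j l : nat) : nat :=
  cpair (code (Eq (Add (Var 0) (Var 1)) (Var 2))) (env3 (cst i) (cst j) (cst l)).
Definition fmul (i j l : nat) : nat :=
  cpair (code (Eq (Mul (Var 0) (Var 1)) (Var 2))) (env3 (cst i) (cst j) (cst l)).

Definition fact (M : structure) (v : nat -> M) : oracle := fun k i j l =>
  match k with
  | 0 => s_add M (v i) (v j) = v l
  | 1 => s_mul M (v i) (v j) = v l
  | _ => s_lt M (v i) (v j)
  end.

(** [R k a] says that [k] witnesses that [a] codes an axiom, and [O] is a
    positive diagram of the constants. *)
Definition refuted (R : nat -> nat -> Prop) (O : oracle) (n d : nat) (P Q : nat -> Prop) : Prop :=
  (exists x, x < n /\ exists y, y < n /\ exists z, z < n /\ exists t, t < n /\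
     violates P Q (scons x (scons y (scons z (fun _ => t)))) henkin_clauses) \/
  (exists a, a < n /\ exists k, k < n /\ (R k a /\ Q (cpair a 0))) \/
  Q (cpair d (env2 (cst 0) (cst 1))) \/
  (exists i, i < n /\ exists j, j < n /\ exists l, l < n /\ (O 0 i j l /\ Q (fadd i j l))) \/
  (exists i, i < n /\ exists j, j < n /\ exists l, l < n /\ (O 1 i j l /\ Q (fmul i j l))) \/
  (exists i, i < n /\ exists j, j < n /\ (O 2 i j 0 /\ Q (ltn (cst i) (cst j)))).

Lemma Abs_refuted w R (fn0 fd : (nat -> nat) -> nat)
  (P Q : oracle -> (nat -> nat) -> nat -> Prop) :
  Abs w (fun O r => R (r 0) (r 1)) -> Fn w fn0 -> Fn w fd ->
  (forall (s : nat -> nat) f, Fn w f -> Abs w (fun O r => P O (fun n => r (s n)) (f r))) ->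
  (forall (s : nat -> nat) f, Fn w f -> Abs w (fun O r => Q O (fun n => r (s n)) (f r))) ->
  Abs w (fun O r => refuted R O (fn0 r) (fd r) (P O r) (Q O r)).
Proof.
  intros HR Hn Hd HP HQ. unfold refuted.
  assert (Hs : forall s, Fn w (fun r => fn0 (fun k => r (s k)))) by (intros; apply Fn_ren, Hn).
  repeat apply Abs_or.
  - apply Abs_bex; [assumption|]. apply (Abs_bex w); [apply (Hs S)|].
    apply Abs_bex; [apply (Hs (fun k => S (S k)))|].
    apply Abs_bex; [apply (Hs (fun k => S (S (S k))))|]. cbv beta.
    eapply Abs_iff; [|apply (Abs_violates w
       (fun O r => P O (fun n => r (S (S (S (S n)))))) (fun O r => Q O (fun n => r (S (S (S (S n))))))
       (fun k => match k with 0 => 3 | 1 => 2 | 2 => 1 | _ => 0 end) henkin_clauses)].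
    + intros O r. cbv beta.
      replace (scons (r 3) (scons (r 2) (scons (r 1) (fun _ => r 0)))) with
        (fun k => r match k with 0 => 3 | 1 => 2 | 2 => 1 | _ => 0 end); [reflexivity|].
      apply functional_extensionality. intros [|[|[|k]]]; reflexivity.
    + intros f Hf. apply (HP (fun n => S (S (S (S n))))), Hf.
    + intros f Hf. apply (HQ (fun n => S (S (S (S n))))), Hf.
    + apply Fn_henkin_clauses.
  - apply Abs_bex; [assumption|]. apply (Abs_bex w); [apply (Hs S)|]. apply Abs_and.
    + apply (Abs_ren w (fun k => match k with 0 => 0 | _ => 1 end) _ HR).
    + apply (HQ (fun n => S (S n)) (fun r => cpair (r 1) 0)). fn.
  - apply (HQ (fun n => n)). apply Fn_cpair; [assumption|apply Fn_const].
  - apply Abs_bex; [assumption|]. apply (Abs_bex w); [apply (Hs S)|].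
    apply Abs_bex; [apply (Hs (fun k => S (S k)))|]. apply Abs_and.
    + apply Abs_oracle; fn.
    + apply (HQ (fun n => S (S (S n))) (fun r => fadd (r 2) (r 1) (r 0))).
      apply Fn_cpair; [apply Fn_const|]. apply Fn_env3; apply Fn_cst; fn.
  - apply Abs_bex; [assumption|]. apply (Abs_bex w); [apply (Hs S)|].
    apply Abs_bex; [apply (Hs (fun k => S (S k)))|]. apply Abs_and.
    + apply Abs_oracle; fn.
    + apply (HQ (fun n => S (S (S n))) (fun r => fmul (r 2) (r 1) (r 0))).
      apply Fn_cpair; [apply Fn_const|]. apply Fn_env3; apply Fn_cst; fn.
  - apply Abs_bex; [assumption|]. apply (Abs_bex w); [apply (Hs S)|]. apply Abs_and.
    + apply Abs_oracle; fn.
    + apply (HQ (fun n => S (S n)) (fun r => ltn (cst (r 1)) (cst (r 0)))).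
      apply Fn_ltn; apply Fn_cst; fn.
Qed.

Lemma refuted_mono R O n d (P Q P' Q' : nat -> Prop) :
  (forall i, P i -> P' i) -> (forall i, Q i -> Q' i) ->
  refuted R O n d P Q -> refuted R O n d P' Q'.
Proof.
  intros HP HQ. unfold refuted.
  intros [(x & Hx & y & Hy & z & Hz & t & Ht & V)|H].
  { left. exists x; split; auto. exists y; split; auto. exists z; split; auto.
    exists t; split; auto. eapply violates_mono; eauto. }
  right. destruct H as [(a & Ha & k & Hk & H1 & H2)|[H|[H|[H|H]]]].
  - left. exists a; split; auto. exists k; auto.
  - right; left; auto.
  - right; right; left. destruct H as (i & Hi & j & Hj & l & Hl & H1 & H2).
    exists i; split; auto. exists j; split; auto. exists l; auto.
  - right; right; right; left. destruct H as (i & Hi & j & Hj & l & Hl & H1 & H2).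
    exists i; split; auto. exists j; split; auto. exists l; auto.
  - right; right; right; right. destruct H as (i & Hi & j & Hj & H1 & H2).
    exists i; split; auto. exists j; auto.
Qed.

Section Refutation.
Variables (A : theory) (R : nat -> nat -> Prop).
Hypothesis A_sentences : forall p, A p -> sentence p.
Hypothesis HR : forall n, (exists p, A p /\ code p = n) <-> exists k, R k n.

(** Soundness of the stages: truth in a model of the axioms, the facts and the formula coded by [d]
    is an assignment that no stage can refute. *)
Lemma not_refuted (N : structure) (v : nat -> N) (O : oracle) d n :
  models N A ->
  (forall r, sat N (scons (v 0) (scons (v 1) r)) (dec d)) ->
  (forall k i j l, k < 3 -> O k i j l -> fact N v k i j l) ->
  ~ refuted R O n d (assignment N v) (fun i => ~ assignment N v i).
Proof.
  intros HN Hd HO.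
  pose proof (name_cst N v) as Hc.
  assert (H3 : forall p x y z, assignment N v (cpair p (env3 x y z)) =
    sat N (scons (name N v x) (scons (name N v y) (scons (name N v z) (nenv N v 0)))) (dec p)).
  { intros. unfold env3. rewrite assignment_cpair, !nenv_cpair. reflexivity. }
  intros [H|[H|[H|[H|[H|H]]]]].
  - destruct H as (x & _ & y & _ & z & _ & t & _ & V). revert V.
    apply henkin_violates, assignment_henkin.
  - destruct H as (a & _ & k & _ & Hk & Ha). apply Ha.
    destruct (proj2 (HR a) (ex_intro _ k Hk)) as [p [Hp <-]].
    rewrite assignment_cpair, dec_code. apply HN, Hp.
  - apply H. unfold env2. rewrite assignment_cpair, !nenv_cpair, !Hc. apply Hd.
  - destruct H as (i & _ & j & _ & l & _ & Hf & Hn). apply Hn. unfold fadd.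
    rewrite H3, dec_code, !Hc. apply (HO 0 i j l); [lia|exact Hf].
  - destruct H as (i & _ & j & _ & l & _ & Hf & Hn). apply Hn. unfold fmul.
    rewrite H3, dec_code, !Hc. apply (HO 1 i j l); [lia|exact Hf].
  - destruct H as (i & _ & j & _ & Hf & Hn). apply Hn.
    rewrite assignment_ltn, !Hc. apply (HO 2 i j 0); [lia|exact Hf].
Qed.

(** It contains all final segments, so along it every fixed bit is eventually among those
    inspected. *)
Lemma tail_ultrafilter : exists U, ultrafilter nat U /\ forall n, U (fun m => n < m).
Proof.
  apply (ultrafilter_extends nat nat 0 (fun n m => n < m)).
  - intros n. exists (S n). lia.
  - intros j k. exists (j + k). intros; lia.
Qed.

(** The model is read off the ultralimit of the assignments [X n]. *)
Lemma unrefuted_model (F : oracle) (O : nat -> oracle) (q0 : form) (X : nat -> nat -> Prop) :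
  (forall n k i j l, i < n -> j < n -> l < n -> F k i j l -> O n k i j l) ->
  (forall n, ~ refuted R (O n) n (code q0) (fun i => i < n /\ X n i) (fun i => i < n /\ ~ X n i)) ->
  exists (N : structure) (v : nat -> N), models N A /\
    (exists r, sat N (scons (v 0) (scons (v 1) r)) q0) /\
    (forall k i j l, k < 2 -> F k i j l -> fact N v k i j l) /\
    (forall i j, F 2 i j 0 -> fact N v 2 i j 0).
Proof.
  intros HO Hn. destruct tail_ultrafilter as [U [HU Ut]].
  pose (L := fun i => U (fun n => X n i)).
  assert (LT : forall i, L i -> U (fun n => i < n /\ X n i))
    by (intros; apply (uf_and nat U HU); auto).
  assert (LF : forall i, ~ L i -> U (fun n => i < n /\ ~ X n i)).
  { intros i Hi. apply (uf_and nat U HU); auto. apply (uf_not nat U HU), Hi. }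
  (* Each requirement on the limit is met for the same reason: if it failed, the finitely many bits
     showing this would be inspected at almost all stages, and one such stage would already be
     refuted. *)
  assert (K : forall B : nat -> Prop, U B ->
    (forall n, B n -> refuted R (O n) n (code q0) (fun i => i < n /\ X n i) (fun i => i < n /\ ~ X n i)) -> False).
  { intros B HB H. apply (uf_false nat U HU). revert HB. apply (uf_mono nat U HU).
    intros n Bn. exact (Hn n (H n Bn)). }
  assert (HL : henkin L).
  { apply henkin_violates. intros r V.
    assert (V' : violates L (fun i => ~ L i)
       (scons (r 0) (scons (r 1) (scons (r 2) (fun _ => r 3)))) henkin_clauses) by exact V.
    apply (violates_mono _ _ _ _ _ _ LT LF) in V'. apply (violates_ultra nat U HU) in V'.
    refine (K _ (uf_and nat U HU _ _ V' (Ut (r 0 + r 1 + r 2 + r 3))) _).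
    intros n [Vn Ln]. left. exists (r 0); split; [lia|]. exists (r 1); split; [lia|].
    exists (r 2); split; [lia|]. exists (r 3); split; [lia|exact Vn]. }
  destruct (henkin_structure L HL) as [N [q [Hq HN]]].
  assert (E2 : forall x y, (fun n => q (env (env2 x y) n)) =
            scons (q x) (scons (q y) (fun n => q (env 0 n)))).
  { intros. unfold env2. rewrite !env_cpair. apply functional_extensionality.
    intros [|[|n]]; reflexivity. }
  assert (E3 : forall x y z, (fun n => q (env (env3 x y z) n)) =
            scons (q x) (scons (q y) (scons (q z) (fun n => q (env 0 n))))).
  { intros. unfold env3. rewrite !env_cpair. apply functional_extensionality.
    intros [|[|[|n]]]; reflexivity. }
  exists N, (fun i => q (cst i)). split; [|split; [|split]].
  - intros p Hp r. apply (sat_sentence N p r (fun n => q (env 0 n)) (A_sentences p Hp)).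
    apply HN. apply NNPP. intros Hno.
    destruct (proj1 (HR (code p))) as [k Hk]; [eauto|].
    refine (K _ (uf_and nat U HU _ _ (LF _ Hno) (Ut (code p + k))) _).
    intros n [Vn Ln]. right; left. exists (code p); split; [lia|]. exists k; split; [lia|]. auto.
  - exists (fun n => q (env 0 n)). rewrite <- E2. apply HN. apply NNPP. intros Hno.
    refine (K _ (LF _ Hno) _). intros n Vn. right; right; left. exact Vn.
  - intros k i j l Lk HF.
    assert (HF' : forall n, i + j + l < n -> O n k i j l) by (intros; apply HO; auto; lia).
    destruct k as [|[|k]]; [| |lia]; simpl.
    + pose proof (HN (Eq (Add (Var 0) (Var 1)) (Var 2)) (env3 (cst i) (cst j) (cst l))) as S.
      rewrite E3 in S. apply S. apply NNPP. intros Hno.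
      refine (K _ (uf_and nat U HU _ _ (LF _ Hno) (Ut (i + j + l))) _).
      intros n [Vn Ln]. right; right; right; left. exists i; split; [lia|].
      exists j; split; [lia|]. exists l; split; [lia|]. auto.
    + pose proof (HN (Eq (Mul (Var 0) (Var 1)) (Var 2)) (env3 (cst i) (cst j) (cst l))) as S.
      rewrite E3 in S. apply S. apply NNPP. intros Hno.
      refine (K _ (uf_and nat U HU _ _ (LF _ Hno) (Ut (i + j + l))) _).
      intros n [Vn Ln]. right; right; right; right; left. exists i; split; [lia|].
      exists j; split; [lia|]. exists l; split; [lia|]. auto.
  - intros i j HF. simpl.
    pose proof (HN (Lt (Var 0) (Var 1)) (env2 (cst i) (cst j))) as S.
    rewrite E2 in S. apply S. apply NNPP. intros Hno.
    refine (K _ (uf_and nat U HU _ _ (LF _ Hno) (Ut (i + j))) _).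
    intros n [Vn Ln]. right; right; right; right; right. exists i; split; [lia|].
    exists j; split; [lia|]. split; [|exact Vn]. apply HO; auto; lia.
Qed.
End Refutation.

(** * Nonstandard elements *)

Lemma betaf_sig a b i v : { q : form | forall (M : structure) (r : nat -> M),
  sat M r q <-> beta M (teval M r a) (teval M r b) (teval M r i) (teval M r v) }.
Proof.
  exists (subst (scons a (scons b (scons i (fun _ => v)))) beta_form).
  intros M r. rewrite sat_subst, sat_beta. reflexivity.
Qed.

Definition betaf (a b i v : term) : form := proj1_sig (betaf_sig a b i v).

Lemma sat_betaf (M : structure) (r : nat -> M) a b i v :
  sat M r (betaf a b i v) <->
  beta M (teval M r a) (teval M r b) (teval M r i) (teval M r v).
Proof. exact (proj2_sig (betaf_sig a b i v) M r). Qed.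

(** Under the three quantifiers, variables 3 to 8 are [a], [b], [k], [i], [j], [l] in the order of
    [env6]; [k] selects sum, product or order. *)
Definition fact_form : form :=
  Ex (Ex (Ex (And (betaf (Var 3) (Var 4) (Var 6) (Var 2))
    (And (betaf (Var 3) (Var 4) (Var 7) (Var 1))
    (And (betaf (Var 3) (Var 4) (Var 8) (Var 0))
    (And (Imp (Eq (Var 5) Zero) (Eq (Add (Var 2) (Var 1)) (Var 0)))
    (And (Imp (Eq (Var 5) One) (Eq (Mul (Var 2) (Var 1)) (Var 0)))
         (Imp (Eq (Var 5) (Add One One)) (Lt (Var 2) (Var 1)))))))))).

Lemma fact_form_spec (M : structure) (a b : M) k i j l : models M PA -> k < 3 ->
  orc fact_form M a b k i j l <->
  exists v : nat -> M, beta M a b (value M i) (v i) /\ beta M a b (value M j) (v j) /\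
    beta M a b (value M l) (v l) /\ fact M v k i j l.
Proof.
  intros HM Hk. unfold orc, fact_form. rewrite sat_Ex. setoid_rewrite sat_Ex.
  setoid_rewrite sat_Ex. repeat setoid_rewrite sat_And. repeat setoid_rewrite sat_betaf.
  cbn -[value]. 
  assert (E0 : forall n, value M n = s_zero M <-> n = 0).
  { intros n. split; [apply (value_inj M HM n 0)|intros ->; reflexivity]. }
  assert (E1 : forall n, value M n = s_one M <-> n = 1).
  { intros n. rewrite <- (value_one M HM). split; [apply (value_inj M HM)|intros ->; auto]. }
  assert (E2 : forall n, value M n = s_add M (s_one M) (s_one M) <-> n = 2).
  { intros n. rewrite <- (value_one M HM) at 1.
    change (value M n = value M 2 <-> n = 2). split; [apply (value_inj M HM)|intros ->; auto]. }
  setoid_rewrite E0. setoid_rewrite E1. setoid_rewrite E2.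
  split.
  - intros (x & y & z & Hx & Hy & Hz & H0 & H1 & H2).
    (* The indices may coincide; then uniqueness of beta values makes the overlapping cases
       agree. *)
    exists (fun n => if n =? i then x else if n =? j then y else z).
    assert (Ei : i =? i = true) by apply Nat.eqb_refl.
    assert (Ej : (if j =? i then x else if j =? j then y else z) = y).
    { rewrite Nat.eqb_refl. destruct (Nat.eqb_spec j i) as [->|]; auto.
      eapply (beta_unique M HM); eauto. }
    assert (El : (if l =? i then x else if l =? j then y else z) = z).
    { destruct (Nat.eqb_spec l i) as [->|]; [eapply (beta_unique M HM); eauto|].
      destruct (Nat.eqb_spec l j) as [->|]; auto. eapply (beta_unique M HM); eauto. }
    unfold fact. rewrite Ei, Ej, El. do 3 (split; [assumption|]).
    destruct k as [|[|[|k]]]; [apply H0|apply H1|apply H2|lia]; reflexivity.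
  - intros (v & Hx & Hy & Hz & Hf). exists (v i), (v j), (v l).
    do 3 (split; [assumption|]). repeat split; intros ->; exact Hf.
Qed.

(** The divisors [(i + 1) * D + 1], [i < n], of [B] are pairwise coprime, so
    that the numbers below [B] code all truth assignments to [n] bits. *)
Definition stage (R : nat -> nat -> Prop) (O : oracle) (n D B d : nat) : Prop :=
  (0 < D /\ (forall j, j < n -> exists q, q < D + 1 /\ D = q * (j + 1))) /\
  (0 < B /\ (forall j, j < n -> exists q, q < B + 1 /\ B = q * ((j + 1) * D + 1))) /\
  forall c, c < B -> refuted R O n d
    (fun i => i < n /\ exists q, q < c + 1 /\ c = q * ((i + 1) * D + 1))
    (fun i => i < n /\ ~ exists q, q < c + 1 /\ c = q * ((i + 1) * D + 1)).

Lemma Abs_stage w R : Abs w (fun O r => R (r 0) (r 1)) ->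
  Abs w (fun O r => stage R O (r 0) (r 1) (r 2) (r 3)).
Proof.
  intros HR. unfold stage. apply Abs_and; [abs|]. apply Abs_and; [abs|].
  apply Abs_ball; [fn|]. cbv beta.
  assert (HB : forall (s : nat -> nat) f, Fn w f -> Abs w (fun (O : oracle) r => 
    exists q, q < r (s 0) + 1 /\ r (s 0) = q * ((f r + 1) * r (s 2) + 1))).
  { intros s f Hf. apply Abs_bex; [fn|].
    apply Abs_eq; fn. apply Fn_ren, Hf. }
  apply (Abs_refuted w R (fun r => r 1) (fun r => r 4)
    (fun O r i => i < r 1 /\ exists q, q < r 0 + 1 /\ r 0 = q * ((i + 1) * r 2 + 1))
    (fun O r i => i < r 1 /\ ~ exists q, q < r 0 + 1 /\ r 0 = q * ((i + 1) * r 2 + 1)));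
    [exact HR|fn|fn| |].
  - intros s f Hf. apply Abs_and; [apply Abs_lt; fn; assumption|]. apply (HB s f Hf).
  - intros s f Hf. apply Abs_and; [apply Abs_lt; fn; assumption|].
    apply Abs_not, (HB s f Hf).
Qed.

(** Entries 0 and 1 of the sequence are [y] and [d], so that [cst 0] and [cst 1] name them in the
    refuted theory. The numbers of the stage are bounded by [y] and hence standard when [y] is; [a]
    and [b] are unbounded, as they code elements of [M]. *)
Definition nonstd_form (p : form) : form :=
  Ex (Ex (And (betaf (Var 1) (Var 0) Zero (Var 2))
    (And (betaf (Var 1) (Var 0) One (Var 3))
    (Ex (Ex (Ex (And (Lt (Var 2) (Var 5)) (And (Lt (Var 1) (Var 5)) (And (Lt (Var 0) (Var 5))
      (subst (env6 (Var 4) (Var 3) (Var 2) (Var 1) (Var 0) (Var 6) Zero) p)))))))))).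

Lemma nonstd_form_spec (M : structure) (r : nat -> M) p :
  sat M r (nonstd_form p) <-> exists a b, beta M a b (s_zero M) (r 0) /\
    beta M a b (s_one M) (r 1) /\ exists n D B,
    s_lt M n (r 0) /\ s_lt M D (r 0) /\ s_lt M B (r 0) /\
    sat M (env6 a b n D B (r 1) (s_zero M)) p.
Proof.
  unfold nonstd_form. repeat (setoid_rewrite sat_Ex || setoid_rewrite sat_And
    || setoid_rewrite sat_betaf || setoid_rewrite sat_subst).
  assert (E : forall a b n D B : M, sat M (fun k => teval M
     (scons B (scons D (scons n (scons b (scons a r)))))
     (env6 (Var 4) (Var 3) (Var 2) (Var 1) (Var 0) (Var 6) Zero k)) p <->
     sat M (env6 a b n D B (r 1) (s_zero M)) p).
  { intros. apply sat_ext. intros [|[|[|[|[|[|k]]]]]]; reflexivity. }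
  setoid_rewrite E. reflexivity.
Qed.

(** * Embeddings and positive diagrams *)

Definition preserves (M N : structure) (e : M -> N) (S : M -> Prop) : Prop :=
  forall x y z, S x -> S y -> S z ->
    (s_add M x y = z -> s_add N (e x) (e y) = e z) /\
    (s_mul M x y = z -> s_mul N (e x) (e y) = e z) /\
    (s_lt M x y -> s_lt N (e x) (e y)).

(** Positive facts suffice because models of PA are linearly ordered: a strictly monotone map is
    injective and reflects the order. *)
Lemma preserves_embedding (M N : structure) (e : M -> N) :
  models M PA -> models N PA -> preserves M N e (fun _ => True) -> embedding M N e.
Proof.
  intros HM HN He.
  assert (Ha : forall x y, e (s_add M x y) = s_add N (e x) (e y))
    by (intros x y; symmetry; apply (He x y _ I I I); reflexivity).
  assert (Hm : forall x y, e (s_mul M x y) = s_mul N (e x) (e y))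
    by (intros x y; symmetry; apply (He x y _ I I I); reflexivity).
  assert (Hl : forall x y, s_lt M x y -> s_lt N (e x) (e y))
    by (intros x y; apply (He x y x I I I)).
  assert (H0 : e (s_zero M) = s_zero N).
  { apply (pa_add_cancel N HN _ _ (e (s_zero M))).
    rewrite <- Ha, (pa_add_zero M HM), (pa_zero_add N HN). reflexivity. }
  assert (H1 : e (s_one M) = s_one N).
  (* The image of 1 is a positive idempotent. Writing it as z + 1 and cancelling gives (z + 1)z = 0,
     so z = 0. *)
  { assert (L : s_lt N (s_zero N) (e (s_one M))).
    { rewrite <- H0. apply Hl. apply (pa_lt M HM). exists (s_zero M).
      rewrite !(pa_zero_add M HM). reflexivity. }
    assert (E : s_mul N (e (s_one M)) (e (s_one M)) = e (s_one M))
      by (rewrite <- Hm, (pa_mul_one M HM); reflexivity).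
    apply (pa_lt N HN) in L. destruct L as [z Hz]. rewrite (pa_zero_add N HN) in Hz.
    assert (E' : s_add N (s_mul N (e (s_one M)) z) (e (s_one M)) =
                 s_add N (s_zero N) (e (s_one M)))
      by (rewrite <- (pa_mul_succ N HN), Hz, (pa_zero_add N HN); exact E).
    apply (pa_add_cancel N HN) in E'. clear E. rename E' into E.
    rewrite <- Hz, (pa_add_mul N HN), (pa_one_mul N HN) in E.
    apply (pa_add_zero_inv N HN) in E. subst z. rewrite <- Hz. apply (pa_zero_add N HN). }
  assert (Hinj : forall x y, e x = e y -> x = y).
  { intros x y E. destruct (pa_total M HM x y) as [L|[L|L]]; auto; apply Hl in L;
      rewrite E in L; exfalso; exact (pa_lt_irrefl N HN _ L). }
  constructor; auto.
  intros x y. split; auto. intros L. destruct (pa_total M HM x y) as [L'|[->|L']]; auto.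
  - exfalso; exact (pa_lt_irrefl N HN _ L).
  - exfalso. apply Hl in L'. exact (pa_lt_irrefl N HN _ (pa_lt_trans N HN _ _ _ L L')).
Qed.

Lemma embedding_value (M N : structure) (e : M -> N) n :
  embedding M N e -> e (value M n) = value N n.
Proof.
  intros He. induction n; simpl; [apply (emb_zero He)|].
  rewrite (emb_add He), (emb_one He), IHn. reflexivity.
Qed.

Lemma embedding_id (M : structure) : embedding M M (fun x => x).
Proof. constructor; auto; reflexivity. Qed.

Section Nonstandard.
Variables (A : theory) (R : nat -> nat -> Prop) (p : form).
Hypothesis A_sentences : forall p, A p -> sentence p.
Hypothesis A_PA : extends_PA A.
Hypothesis HR : forall n, (exists p, A p /\ code p = n) <-> exists k, R k n.
Hypothesis Hp : forall (M : structure) (a b : M) (r : nat -> nat), models M PA ->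
  (sat M (scons a (scons b (fun n => value M (r n)))) p <->
   stage R (orc fact_form M a b) (r 0) (r 1) (r 2) (r 3)).

Let D := nonstd_form p.
Let dv (M : structure) : M := value M (code D).

Lemma nonstd_form_ext (M : structure) (r r' : nat -> M) :
  r 0 = r' 0 -> r 1 = r' 1 -> sat M r D <-> sat M r' D.
Proof. intros E0 E1. unfold D. rewrite !nonstd_form_spec, E0, E1. reflexivity. Qed.

Lemma stage_at_code (M : structure) (a b : M) n C B : models M PA ->
  sat M (env6 a b (value M n) (value M C) (value M B) (dv M) (s_zero M)) p <->
  stage R (orc fact_form M a b) n C B (code D).
Proof.
  intros HM.
  rewrite <- (Hp M a b (scons n (scons C (scons B (scons (code D) (fun _ => 0))))) HM).
  apply sat_ext. intros [|[|[|[|[|[|k]]]]]]; reflexivity.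
Qed.

(** If [M] satisfied [D], all numbers of the stage would be standard and the refutation genuine. But
    [M] is itself a model of everything refuted: of [A], of the facts read in it, and of [D] by
    assumption. *)
Lemma standard_not_D (M : structure) n (r : nat -> M) : models M A ->
  ~ sat M (scons (value M n) (scons (dv M) r)) D.
Proof.
  intros HM HD. pose proof (models_PA A M A_PA HM) as HPA.
  pose proof HD as HD0. unfold D in HD. rewrite nonstd_form_spec in HD. fold D in HD.
  destruct HD as (a & b & Hy & Hd & n' & C' & B' & Ln & LC & LB & Hs).
  apply (lt_value M HPA) in Ln as (k & _ & ->).
  apply (lt_value M HPA) in LC as (C & _ & ->).
  apply (lt_value M HPA) in LB as (B & _ & ->).
  cbn [scons] in *. apply (stage_at_code M a b k C B HPA) in Hs. destruct Hs as ((C0 & HC) & (B0 & HB) & Hc).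
  (* The constants are interpreted by the entries of the beta sequence, and arbitrarily where it has
     no value. *)
  pose (v := fun i => epsilon (inhabits (s_zero M)) (beta M a b (value M i))).
  assert (Hv : forall i x, beta M a b (value M i) x -> v i = x).
  { intros i x Hx. eapply (beta_unique M HPA); [|exact Hx].
    apply (epsilon_spec (inhabits (s_zero M))). eauto. }
  destruct (bit_pattern k C B (assignment M v)) as (c & Lc & Hbit); auto.
  { intros j Hj. destruct (HC j Hj) as (q & _ & E). eauto. }
  { intros j Hj. destruct (HB j Hj) as (q & _ & E). eauto. }
  assert (Hbit' : forall j, j < k -> assignment M v j <->
     exists q, q < c + 1 /\ c = q * ((j + 1) * C + 1)).
  { intros j Hj. rewrite <- (Hbit j Hj), std_bit. split; intros (q & Lq & E); exists q;
      split; auto; lia. }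
  refine (not_refuted A R HR M v (orc fact_form M a b) (code D) k HM _ _
    (refuted_mono _ _ _ _ _ _ _ _ _ _ (Hc c Lc))).
  - intros r'. rewrite dec_code. apply (nonstd_form_ext M (scons (value M n) (scons (dv M) r))); auto.
    + symmetry. apply Hv, Hy.
    + symmetry. apply Hv. rewrite (value_one M HPA). exact Hd.
  - intros f i j l Lf HO. apply fact_form_spec in HO; auto.
    destruct HO as (v' & Hi & Hj & Hl & Hf). unfold fact in *.
    rewrite (Hv _ _ Hi), (Hv _ _ Hj), (Hv _ _ Hl). exact Hf.
  - intros i [Li Hi]. apply Hbit'; auto.
  - intros i [Li Hi]. rewrite Hbit'; auto.
Qed.

(** Compactness in the form of an ultraproduct over finite lists: maps respecting larger and larger
    finite parts of the diagram combine to an embedding of [M]. *)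
Lemma diagram_compactness (M : structure) (y : M) : models M A ->
  ~ (exists (N : structure) (e : M -> N), models N A /\ embedding M N e /\
       forall r, sat N (scons (e y) (scons (dv N) r)) D) ->
  exists L : list M, ~ exists (N : structure) (e : M -> N), models N A /\
    preserves M N e (fun x => In x L) /\
    exists r, sat N (scons (e y) (scons (e (dv M)) r)) D.
Proof.
  intros HM Hno. apply NNPP. intros Hall. apply Hno. clear Hno.
  assert (HF : forall L : list M, exists Ne : {N : structure & M -> N},
    models (projT1 Ne) A /\ preserves M (projT1 Ne) (projT2 Ne) (fun x => In x L) /\
    exists r, sat (projT1 Ne) (scons (projT2 Ne y) (scons (projT2 Ne (dv M)) r)) D).
  { intros L. apply NNPP. intros H. apply Hall. exists L. intros (N & e & HN).
    apply H. exists (existT _ N e). exact HN. }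
  pose (N := fun L => projT1 (proj1_sig (constructive_indefinite_description _ (HF L)))).
  pose (e := fun L => projT2 (proj1_sig (constructive_indefinite_description _ (HF L))) : M -> N L).
  assert (HN : forall L, models (N L) A /\ preserves M (N L) (e L) (fun x => In x L) /\
    exists r, sat (N L) (scons (e L y) (scons (e L (dv M)) r)) D).
  { intros L. exact (proj2_sig (constructive_indefinite_description _ (HF L))). }
  clearbody N e. clear HF Hall.
  (* The filter is generated by the cones of lists including a given list, so every finite set of
     elements lies in almost all lists. *)
  destruct (ultrafilter_extends (list M) (list M) nil (fun K L => incl K L)) as [U [HU HUF]].
  { intros K. exists K. apply incl_refl. }
  { intros J K. exists (J ++ K). intros L H. split; intros x Hx; apply H, in_or_app; auto. }
  pose (W := ultraproduct (list M) U N).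
  pose (f := fun x => ucls (list M) U N (fun L => e L x) : W).
  assert (HW : models W A) by (apply (ultraproduct_models _ U HU); intros L; apply HN).
  assert (Hf : embedding M W f).
  { apply preserves_embedding; [eapply models_PA; eauto|eapply models_PA; eauto|].
    intros x1 x2 x3 _ _ _.
    assert (Hin : U (fun L => In x1 L /\ In x2 L /\ In x3 L)).
    { generalize (HUF (x1 :: x2 :: x3 :: nil)). apply (uf_mono _ U HU).
      intros L H. repeat split; apply H; simpl; auto. }
    pose (r := fun n (L : list M) => e L match n with 0 => x1 | 1 => x2 | _ => x3 end).
    split; [|split]; intros H.
    - apply (los _ U HU N (Eq (Add (Var 0) (Var 1)) (Var 2)) r).
      revert Hin. apply (uf_mono _ U HU). intros L (H1 & H2 & H3).
      apply (proj1 (proj2 (HN L)) x1 x2 x3 H1 H2 H3). exact H.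
    - apply (los _ U HU N (Eq (Mul (Var 0) (Var 1)) (Var 2)) r).
      revert Hin. apply (uf_mono _ U HU). intros L (H1 & H2 & H3).
      apply (proj1 (proj2 (HN L)) x1 x2 x3 H1 H2 H3). exact H.
    - apply (los _ U HU N (Lt (Var 0) (Var 1)) r).
      revert Hin. apply (uf_mono _ U HU). intros L (H1 & H2 & H3).
      apply (proj1 (proj2 (HN L)) x1 x2 x3 H1 H2 H3). exact H. }
  exists W, f. split; [exact HW|split; [exact Hf|]]. intros r.
  (* The partial maps need not send the numeral [dv M] to a numeral; the limit does, being an
     embedding. *)
  unfold dv. rewrite <- (embedding_value M W f (code D) Hf). fold (dv M).
  pose (s := fun n (L : list M) => e L match n with 0 => y | _ => dv M end).
  apply (nonstd_form_ext W (fun n => ucls (list M) U N (s n))); [reflexivity|reflexivity|].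
  apply (los _ U HU N D s). apply (uf_all _ U HU). intros L.
  destruct (HN L) as (_ & _ & r' & Hr'). revert Hr'.
  apply nonstd_form_ext; reflexivity.
Qed.

Lemma nonstandard_D (M : structure) (y : M) : models M A ->
  (forall n, y <> value M n) ->
  exists (N : structure) (e : M -> N), models N A /\ embedding M N e /\
    forall r, sat N (scons (e y) (scons (dv N) r)) D.
Proof.
  intros HM Hy. apply NNPP. intros Hno.
  destruct (diagram_compactness M y HM Hno) as [L HL].
  (* The extension is [M] itself: the inconsistency of [L] with [A] and [D] is exactly what [D]
     asserts. *)
  apply Hno. exists M, (fun x => x). split; [exact HM|split; [apply embedding_id|]].
  intros r. pose proof (models_PA A M A_PA HM) as HPA.
  (* The list is preceded by [y] and [dv M], the elements named by [cst 0] and [cst 1], and padded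
     with [y]. *)
  pose (v := fun i => match i with 0 => y | 1 => dv M | S (S i) => nth i L y end).
  (* Length [n + 2] ensures that [y] and [dv M] are coded even at stage 0. The sequence may change
     with [n]; only its first entries are ever compared. *)
  assert (Hseq : forall n, exists ab, forall j, j < n + 2 ->
            beta M (fst ab) (snd ab) (value M j) (v j)).
  { intros n. destruct (beta_sequence M HPA (n + 2) v) as (a & b & H). exists (a, b). exact H. }
  pose (ab := fun n => proj1_sig (constructive_indefinite_description _ (Hseq n))).
  assert (Hab : forall n j, j < n + 2 -> beta M (fst (ab n)) (snd (ab n)) (value M j) (v j)).
  { intros n. exact (proj2_sig (constructive_indefinite_description _ (Hseq n))). }
  pose (O := fun n => orc fact_form M (fst (ab n)) (snd (ab n))).
  (* Either one stage refutes all assignments, and [M] satisfies [D]; or each stage leaves one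
     unrefuted, and the model obtained from them contradicts the choice of [L]. *)
  destruct (classic (exists n, forall X, refuted R (O n) n (code D)
     (fun i => i < n /\ X i) (fun i => i < n /\ ~ X i))) as [[n Hn]|Hn].
  - destruct (bit_moduli n) as (C & B & C0 & HC & B0 & HB).
    unfold D. rewrite nonstd_form_spec. fold D. exists (fst (ab n)), (snd (ab n)).
    split; [apply (Hab n 0); lia|]. split.
    { cbn [scons]. rewrite <- (value_one M HPA). apply (Hab n 1); lia. }
    exists (value M n), (value M C), (value M B).
    (* The three numbers are standard, however large, and so lie below [y]. *)
    do 3 (split; [apply (nonstandard_gt M HPA), Hy|]). apply (stage_at_code M); auto.
    split; [split; [exact C0|]|split; [split; [exact B0|]|]].
    + intros j Hj. destruct (HC j Hj) as [q Hq]. exists q. split; [nia|exact Hq].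
    + intros j Hj. destruct (HB j Hj) as [q Hq]. exists q. split; [nia|exact Hq].
    + intros c _. apply Hn.
  - exfalso.
    assert (HX : forall n, exists X, ~ refuted R (O n) n (code D)
       (fun i => i < n /\ X i) (fun i => i < n /\ ~ X i)).
    { intros n. apply not_all_ex_not. intros H. apply Hn. exists n. exact H. }
    pose (X := fun n => proj1_sig (constructive_indefinite_description _ (HX n))).
    destruct (unrefuted_model A R A_sentences HR
      (fun k i j l => k < 3 /\ fact M v k i j l) O D X) as (N & w & HN & [r' HD] & HF & HF2).
    + intros n k i j l Hi Hj Hl [Hk Hf]. apply fact_form_spec; auto. exists v.
      repeat (split; [apply Hab; lia|]). exact Hf.
    + intros n. exact (proj2_sig (constructive_indefinite_description _ (HX n))).
    (* An element may occur at several positions of [v]; [y] and [dv M] must be sent to 0 and 1,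
       where [D] holds. They differ because [y] is nonstandard. *)
    + pose (idx := fun x => if excluded_middle_informative (x = y) then 0 else
        if excluded_middle_informative (x = dv M) then 1 else
        epsilon (inhabits 0) (fun i => v i = x)).
      assert (Hidx : forall x, In x L -> v (idx x) = x).
      { intros x Hx. unfold idx. destruct (excluded_middle_informative (x = y)) as [->|]; auto.
        destruct (excluded_middle_informative (x = dv M)) as [->|]; auto.
        apply (epsilon_spec (inhabits 0) (fun i => v i = x)).
        apply In_nth with (d := y) in Hx. destruct Hx as (i & _ & Hi). exists (S (S i)). exact Hi. }
      apply HL. exists N, (fun x => w (idx x)). split; [exact HN|]. split.
      * intros x1 x2 x3 H1 H2 H3. split; [|split]; intros Hf.
        -- apply (HF 0 (idx x1) (idx x2) (idx x3)); [lia|split; [lia|]].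
           unfold fact. rewrite !Hidx; auto.
        -- apply (HF 1 (idx x1) (idx x2) (idx x3)); [lia|split; [lia|]].
           unfold fact. rewrite !Hidx; auto.
        -- apply (HF2 (idx x1) (idx x2)); split; [lia|].
           unfold fact. rewrite !Hidx; auto.
      * assert (E0 : idx y = 0).
        { unfold idx. destruct (excluded_middle_informative (y = y)); tauto. }
        assert (E1 : idx (dv M) = 1).
        { unfold idx. destruct (excluded_middle_informative (dv M = y)) as [E|].
          - exfalso. apply (Hy (code D)). symmetry; exact E.
          - destruct (excluded_middle_informative (dv M = dv M)); tauto. }
        rewrite E0, E1. exists r'. exact HD.
Qed.

End Nonstandard.

(** * The potentialist language *)

Fixpoint pform_of (p : form) : pform :=
  match p with
  | Eq a b => MEq a b
  | Lt a b => MLt a b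
  | Bot => MBot
  | Imp q r => MImp (pform_of q) (pform_of r)
  | All q => MAll (pform_of q)
  end.

Lemma psat_pform_of (A : theory) (M : structure) p : forall r : nat -> M,
  psat A M r (pform_of p) <-> sat M r p.
Proof.
  induction p; intros r; simpl; try reflexivity.
  - rewrite IHp1, IHp2. reflexivity.
  - setoid_rewrite IHp. reflexivity.
Qed.

Definition upr (s : nat -> nat) : nat -> nat := scons 0 (fun n => S (s n)).

(** Renamings pass through the modalities unchanged, because an embedding acts on each entry of the
    environment separately. *)
Fixpoint pren (s : nat -> nat) (p : pform) : pform :=
  match p with
  | MEq a b => MEq (tsubst (fun n => Var (s n)) a) (tsubst (fun n => Var (s n)) b)
  | MLt a b => MLt (tsubst (fun n => Var (s n)) a) (tsubst (fun n => Var (s n)) b)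
  | MBot => MBot
  | MImp q r => MImp (pren s q) (pren s r)
  | MAll q => MAll (pren (upr s) q)
  | MDia q => MDia (pren s q)
  | MBox q => MBox (pren s q)
  end.

Lemma psat_pren (A : theory) p : forall (M : structure) (r : nat -> M) s,
  psat A M r (pren s p) <-> psat A M (fun n => r (s n)) p.
Proof.
  induction p; intros M r s; simpl.
  1,2: rewrite !teval_subst; reflexivity.
  - reflexivity.
  - rewrite IHp1, IHp2. reflexivity.
  - assert (E : forall x, psat A M (scons x r) (pren (upr s) p) <->
                          psat A M (scons x (fun n => r (s n))) p).
    { intros x. rewrite IHp.
      replace (fun n => scons x r (upr s n)) with (scons x (fun n => r (s n)));
        [reflexivity|].
      apply functional_extensionality. intros [|n]; reflexivity. }
    setoid_rewrite E. reflexivity.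
  - setoid_rewrite IHp. reflexivity.
  - setoid_rewrite IHp. reflexivity.
Qed.

Lemma tbelow_tren s k t : (forall n, s n < k) -> tbelow k (tsubst (fun n => Var (s n)) t).
Proof. intros H. induction t; simpl; auto. Qed.

Lemma pbelow_pren p : forall s k, (forall n, s n < k) -> pbelow k (pren s p).
Proof.
  induction p; intros s k H; simpl; auto using tbelow_tren.
  apply IHp. intros [|n]; simpl; [lia|]. specialize (H n). lia.
Qed.

Definition mAnd (p q : pform) : pform := MImp (MImp p (MImp q MBot)) MBot.

Lemma psat_mAnd (A : theory) (M : structure) (r : nat -> M) p q :
  psat A M r (mAnd p q) <-> psat A M r p /\ psat A M r q.
Proof. simpl. tauto. Qed.

Definition mEx (p : pform) : pform := MImp (MAll (MImp p MBot)) MBot.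

Lemma psat_mEx (A : theory) (M : structure) (r : nat -> M) p :
  psat A M r (mEx p) <-> exists x, psat A M (scons x r) p.
Proof.
  simpl. split.
  - intros H. apply NNPP. intros Hn. apply H. intros x Hx. eauto.
  - intros [x Hx] H. exact (H x Hx).
Qed.

(** Coordinate [k] of the ultrapower holds a code in [M] of the part of [S] below [k]. A fixed [n]
    is decided correctly in almost all coordinates, so the class of these codes is correct at every
    standard [n]. *)
Lemma coded_set (A : theory) (M : structure) (S : nat -> Prop) :
  extends_PA A -> models M A -> exists (N : structure) (e : M -> N) (a b : N),
    models N A /\ embedding M N e /\ forall n, bit N a b (value N n) <-> S n.
Proof.
  intros HA HM. pose proof (models_PA A M HA HM) as HPA.
  destruct tail_ultrafilter as [U [HU Ut]].
  pose (N := ultraproduct nat U (fun _ => M)).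
  pose (f := fun x => ucls nat U (fun _ => M) (fun _ => x) : N).
  assert (HN : models N A) by (apply (ultraproduct_models _ U HU); auto).
  assert (Hf : embedding M N f).
  { apply preserves_embedding; [exact HPA|eapply models_PA; eauto|].
    intros x y z _ _ _.
    pose (r := fun n (_ : nat) => match n with 0 => x | 1 => y | _ => z end).
    split; [|split]; intros H.
    - apply (los _ U HU (fun _ => M) (Eq (Add (Var 0) (Var 1)) (Var 2)) r), uf_all; auto.
    - apply (los _ U HU (fun _ => M) (Eq (Mul (Var 0) (Var 1)) (Var 2)) r), uf_all; auto.
    - apply (los _ U HU (fun _ => M) (Lt (Var 0) (Var 1)) r), uf_all; auto. }
  assert (HS : forall k, exists ab, forall j, j < k -> (bit M (fst ab) (snd ab) (value M j) <-> S j)).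
  { intros k. destruct (bit_set M HPA k S) as (a & b & H). exists (a, b). exact H. }
  pose (ab := fun k => proj1_sig (constructive_indefinite_description _ (HS k))).
  assert (Hab : forall k j, j < k -> (bit M (fst (ab k)) (snd (ab k)) (value M j) <-> S j)).
  { intros k. exact (proj2_sig (constructive_indefinite_description _ (HS k))). }
  exists N, f, (ucls nat U (fun _ => M) (fun k => fst (ab k))),
    (ucls nat U (fun _ => M) (fun k => snd (ab k))).
  split; [exact HN|split; [exact Hf|]]. intros n.
  rewrite <- (embedding_value M N f n Hf).
  pose (r := fun m k => match m with 0 => fst (ab k) | 1 => snd (ab k) | _ => value M n end).
  transitivity (sat N (fun m => ucls nat U (fun _ => M) (r m)) bit_form).
  { rewrite sat_bit. reflexivity. }
  unfold N. rewrite (los _ U HU).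
  transitivity (U (fun _ => S n)).
  - apply (uf_iff _ U HU). generalize (Ut n). apply (uf_mono _ U HU). intros k Lk.
    rewrite sat_bit. apply (Hab k n Lk).
  - split; [|intros H; apply uf_all; auto].
    intros H. apply NNPP. intros Hn. apply (uf_false _ U HU). revert H.
    apply (uf_mono _ U HU). auto.
Qed.

(** * Second-order arithmetic over the standard cut *)

Section Definability.
Variables (A : theory) (std_form : pform).
Hypothesis A_PA : extends_PA A.
Hypothesis Hstd : forall (M : structure) (r : nat -> M), models M A ->
  psat A M r std_form <-> exists n, r 0 = value M n.

Definition bits (M : structure) (a b : M) (n : nat) : Prop := bit M a b (value M n).

(** Arithmetical relations over the standard numbers and a set of them coded
    by a pair of parameters. *)
Definition Pot (P : (nat -> Prop) -> (nat -> nat) -> Prop) : Prop :=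
  exists p : pform, forall (M : structure) (a b : M) (r : nat -> nat), models M A ->
    (psat A M (scons a (scons b (fun n => value M (r n)))) p <-> P (bits M a b) r).

Lemma Pot_iff (P Q : (nat -> Prop) -> (nat -> nat) -> Prop) :
  (forall S r, Q S r <-> P S r) -> Pot P -> Pot Q.
Proof. intros H [p Hp]. exists p. intros. rewrite Hp, H; auto. reflexivity. Qed.

Lemma Pot_Abs (P : oracle -> (nat -> nat) -> Prop) :
  Abs bit_form P -> Pot (fun S r => P (fun k _ _ _ => S k) r).
Proof.
  intros [p Hp]. exists (pform_of p). intros M a b r HM.
  rewrite psat_pform_of, Hp by (eapply models_PA; eauto).
  replace (orc bit_form M a b) with (fun k _ _ _ : nat => bits M a b k); [reflexivity|].
  apply functional_extensionality; intros k. apply functional_extensionality; intros i.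
  apply functional_extensionality; intros j. apply functional_extensionality; intros l.
  apply propositional_extensionality. unfold orc. rewrite sat_bit. reflexivity.
Qed.

Lemma Pot_imp P Q : Pot P -> Pot Q -> Pot (fun S r => P S r -> Q S r).
Proof.
  intros [p Hp] [q Hq]. exists (MImp p q). intros M a b r HM. simpl.
  rewrite Hp, Hq; auto. reflexivity.
Qed.

Lemma Pot_not P : Pot P -> Pot (fun S r => ~ P S r).
Proof.
  intros [p Hp]. exists (MImp p MBot). intros M a b r HM. simpl. rewrite Hp; auto. reflexivity.
Qed.

Lemma Pot_and P Q : Pot P -> Pot Q -> Pot (fun S r => P S r /\ Q S r).
Proof.
  intros [p Hp] [q Hq]. exists (mAnd p q). intros M a b r HM.
  rewrite psat_mAnd, Hp, Hq; auto. reflexivity.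
Qed.

Lemma Pot_all (P : (nat -> Prop) -> nat -> (nat -> nat) -> Prop) :
  Pot (fun S r => P S (r 0) (fun n => r (Datatypes.S n))) ->
  Pot (fun S r => forall x, P S x r).
Proof.
  intros [p Hp].
  (* The new variable stands before [a] and [b], whereas [p] expects it after them; the renaming
     rotates the first three places. *)
  exists (MAll (MImp std_form
    (pren (scons 1 (scons 2 (scons 0 (fun n => n + 3)))) p))).
  intros M a b r HM. simpl. setoid_rewrite Hstd; [|exact HM].
  setoid_rewrite psat_pren. cbn [scons].
  assert (E : forall x, psat A M (fun n => scons (value M x) (scons a (scons b (fun k => value M (r k))))
      (scons 1 (scons 2 (scons 0 (fun k => k + 3))) n)) p <-> P (bits M a b) x r).
  { intros x. rewrite <- (Hp M a b (scons x r) HM).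
    match goal with |- psat _ _ ?f _ <-> psat _ _ ?g _ => replace f with g; [reflexivity|] end.
    apply functional_extensionality. intros [|[|[|n]]]; try reflexivity.
    cbn [scons]. replace (n + 3) with (S (S (S n))) by lia. reflexivity. }
  split.
  - intros H x. apply E, H. eauto.
  - intros H y [x ->]. apply E, H.
Qed.

Lemma Pot_ex (P : (nat -> Prop) -> nat -> (nat -> nat) -> Prop) :
  Pot (fun S r => P S (r 0) (fun n => r (Datatypes.S n))) ->
  Pot (fun S r => exists x, P S x r).
Proof.
  intros HP. apply (Pot_iff (fun S r => ~ forall x, ~ P S x r)).
  - intros S r. split.
    + intros [x Hx] H. exact (H x Hx).
    + intros H. apply NNPP. intros Hn. apply H. intros x Hx. eauto.
  - apply Pot_not, (Pot_all (fun S x r => ~ P S x r)), Pot_not, HP.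
Qed.

(** All sets are realized by codes in extensions, and conversely any pair in any extension codes
    some set. The number parameters stay the same, as embeddings preserve numerals. *)
Lemma Pot_set (P : (nat -> Prop) -> (nat -> nat) -> Prop) : Pot P ->
  exists p : pform, forall (M : structure) (r : nat -> nat), models M A ->
    (psat A M (fun n => value M (r n)) p <-> exists S, P S r).
Proof.
  intros [p Hp].
  exists (MDia (mEx (mEx (pren (scons 1 (scons 0 (fun n => n + 2))) p)))).
  intros M r HM.
  assert (E : forall (N : structure) (e : M -> N) a b, models N A -> embedding M N e ->
    psat A N (scons b (scons a (fun n => e (value M (r n)))))
      (pren (scons 1 (scons 0 (fun n => n + 2))) p) <-> P (bits N a b) r).
  { intros N e a b HN He. rewrite psat_pren, <- (Hp N a b r HN).
    match goal with |- psat _ _ ?f _ <-> psat _ _ ?g _ => replace f with g; [reflexivity|] end.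
    apply functional_extensionality. intros [|[|n]]; try reflexivity.
    cbn [scons]. replace (n + 2) with (S (S n)) by lia. cbn [scons].
    symmetry. apply (embedding_value M N e _ He). }
  cbn [psat]. split.
  - intros (N & e & HN & He & H). rewrite psat_mEx in H. destruct H as [a H].
    rewrite psat_mEx in H. destruct H as [b H]. apply (E N e a b HN He) in H. eauto.
  - intros [S HS]. destruct (coded_set A M S A_PA HM) as (N & e & a & b & HN & He & Hab).
    exists N, e. split; [exact HN|split; [exact He|]].
    rewrite psat_mEx. exists a. rewrite psat_mEx. exists b. apply (E N e a b HN He).
    replace (bits N a b) with S; [exact HS|].
    apply functional_extensionality. intros n. apply propositional_extensionality.
    symmetry. apply Hab.
Qed.

End Definability.

(** * Truth in the standard model *)

Definition true_diagram (S : nat -> Prop) (i j : nat) : Prop :=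
  S (fadd i j (i + j)) /\ S (fmul i j (i * j)) /\
  (i = j -> S (eqn (cst i) (cst j))) /\ (S (eqn (cst i) (cst j)) -> i = j) /\
  (i < j -> S (ltn (cst i) (cst j))) /\ (S (ltn (cst i) (cst j)) -> i < j) /\
  S (cpair (code (Eq (Var 0) Zero)) (cpair (cst 0) 0)) /\
  S (cpair (code (Eq (Var 0) One)) (cpair (cst 1) 0)).

(** The constants [cst i] form an isomorphic copy of the standard model in the
    structure described by [S]. *)
Definition truth_set (S : nat -> Prop) (n : nat) : Prop :=
  (forall x y z t, ~ violates S (fun i => ~ S i)
     (scons x (scons y (scons z (fun _ => t)))) henkin_clauses) /\
  (forall i j, true_diagram S i j) /\
  (forall x, exists i, S (eqn x (cst i))) /\
  S (cpair n 0).

Lemma isomorphism_sat (M N : structure) (f : M -> N) :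
  embedding M N f -> (forall y, exists x, y = f x) ->
  forall p r, sat M r p <-> sat N (fun n => f (r n)) p.
Proof.
  intros Hf Hs.
  assert (Ht : forall t r, teval N (fun n => f (r n)) t = f (teval M r t)).
  { induction t; intros r; simpl; auto.
    - symmetry; apply (emb_zero Hf).
    - symmetry; apply (emb_one Hf).
    - rewrite IHt1, IHt2. symmetry; apply (emb_add Hf).
    - rewrite IHt1, IHt2. symmetry; apply (emb_mul Hf). }
  induction p; intros r; simpl.
  - rewrite !Ht. split; [congruence|apply (emb_inj Hf)].
  - rewrite !Ht. apply (emb_lt Hf).
  - reflexivity.
  - rewrite IHp1, IHp2. reflexivity.
  - assert (E : forall x, sat M (scons x r) p <-> sat N (scons (f x) (fun n => f (r n))) p).
    { intros x. rewrite IHp. apply sat_ext. intros [|n]; reflexivity. }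
    split.
    + intros H y. destruct (Hs y) as [x ->]. apply E, H.
    + intros H x. apply E, H.
Qed.

(** Every name being equal to some [cst i] excludes nonstandard elements, so the structure read off
    from [S] is isomorphic to the standard model and must agree with it on [p]. Conversely, truth in
    the standard model is such a set. *)
Lemma truth_set_spec p : sentence p ->
  (exists S, truth_set S (code p)) <-> forall r : nat -> std, sat std r p.
Proof.
  intros Hp. split.
  - intros (S & HV & HD & Hs & HS) r.
    assert (HH : henkin S) by (apply henkin_violates; intros s; exact (HV (s 0) (s 1) (s 2) (s 3))).
    destruct (henkin_structure S HH) as (N & q & Hq & HN).
    assert (E1 : forall x r, (fun n => q (env (cpair x r) n)) =
       scons (q x) (fun n => q (env r n))).
    { intros x s. rewrite env_cpair. apply functional_extensionality. intros [|n]; reflexivity. }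
    assert (Hf : embedding std N (fun i => q (cst i))).
    { constructor.
      - intros i j E. apply (HD i j). apply (HN (Eq (Var 0) (Var 1)) (env2 (cst i) (cst j))).
        unfold env2. rewrite !E1. exact E.
      - destruct (HD 0 0) as (_ & _ & _ & _ & _ & _ & H & _). apply HN in H.
        rewrite E1 in H. exact H.
      - destruct (HD 0 0) as (_ & _ & _ & _ & _ & _ & _ & H). apply HN in H.
        rewrite E1 in H. exact H.
      - intros i j. destruct (HD i j) as (H & _). apply HN in H. unfold env3 in H.
        rewrite !E1 in H. symmetry. exact H.
      - intros i j. destruct (HD i j) as (_ & H & _). apply HN in H. unfold env3 in H.
        rewrite !E1 in H. symmetry. exact H.
      - intros i j. transitivity (S (ltn (cst i) (cst j))).
        + split; apply (HD i j).
        + unfold ltn. rewrite <- HN. unfold env2. rewrite !E1. reflexivity. }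
    assert (Hs' : forall y : N, exists i : std, y = q (cst i)).
    { intros y. destruct (Hq y) as [x ->]. destruct (Hs x) as [i Hi]. exists i.
      apply (HN (Eq (Var 0) (Var 1)) (env2 x (cst i))) in Hi. unfold env2 in Hi.
      rewrite !E1 in Hi. exact Hi. }
    apply (isomorphism_sat std N _ Hf Hs').
    apply (sat_sentence N p _ (fun n => q (env 0 n)) Hp). apply HN, HS.
  - intros H. pose (v := fun i : nat => i : std). pose (S := assignment std v).
    pose proof (assignment_henkin std v) as HH. fold S in HH.
    assert (Hc : forall i, name std v (cst i) = i) by (intros; apply name_cst).
    exists S. split; [|split; [|split]].
    + intros x y z t. exact (proj1 (henkin_violates S) HH _).
    + intros i j. unfold true_diagram, S, fadd, fmul, env3.
      rewrite !assignment_eqn, !assignment_ltn, !assignment_cpair, !dec_code, !nenv_cpair, !Hc.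
      repeat split; auto.
    + intros x. exists (name std v x). unfold S. rewrite assignment_eqn, Hc. reflexivity.
    + unfold S. rewrite assignment_cpair, dec_code. apply H.
Qed.

(** * Codes of sentences *)

Definition term_step (X : nat -> Prop) (k t : nat) : Prop :=
  (exists n, n < k /\ t = cpair 0 n) \/ t = cpair 1 0 \/ t = cpair 2 0 \/
  exists a, a < S t /\ exists b, b < S t /\
    ((t = cpair 3 (cpair a b) \/ t = cpair 4 (cpair a b)) /\
     (X (cpair 0 (cpair k a)) /\ X (cpair 0 (cpair k b)))).

Definition form_step (X : nat -> Prop) (k t : nat) : Prop :=
  t = cpair 2 0 \/
  (exists a, a < S t /\ exists b, b < S t /\
    ((t = cpair 0 (cpair a b) \/ t = cpair 1 (cpair a b)) /\
     (X (cpair 0 (cpair k a)) /\ X (cpair 0 (cpair k b))))) \/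
  (exists a, a < S t /\ exists b, b < S t /\
    (t = cpair 3 (cpair a b) /\
     (X (cpair 1 (cpair k a)) /\ X (cpair 1 (cpair k b))))) \/
  (exists a, a < S t /\ (t = cpair 4 a /\ X (cpair 1 (cpair (S k) a)))).

(** [X (cpair 0 (cpair k t))] and [X (cpair 1 (cpair k t))] say that [t] codes
    a term, respectively a formula, with free variables below [k]. *)
Definition syntax_set (X : nat -> Prop) (n : nat) : Prop :=
  (forall k t, (X (cpair 0 (cpair k t)) -> term_step X k t) /\
               (X (cpair 1 (cpair k t)) -> form_step X k t)) /\
  X (cpair 1 (cpair 0 n)).

(** One implication per step is enough: each step leads to smaller codes, so a set closed under
    inverting the formation rules contains only well-formed codes, by induction on the code. *)
Lemma syntax_set_spec n :
  (exists X, syntax_set X n) <-> exists p, sentence p /\ code p = n.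
Proof.
  split.
  - intros (X & HX & Hn).
    assert (HT : forall m t k, t < m -> X (cpair 0 (cpair k t)) ->
              exists u, tcode u = t /\ tbelow k u).
    { induction m as [|m IH]; intros t k Hlt H; [lia|]. apply HX in H.
      destruct H as [(i & Li & ->)|[->|[->|(a & _ & b & _ & E & Ha & Hb)]]].
      - exists (Var i). simpl. auto.
      - exists Zero. simpl. auto.
      - exists One. simpl. auto.
      - assert (L : a < t /\ b < t).
        { pose proof (cpair_ge a b). pose proof (cpair_ge 3 (cpair a b)).
          pose proof (cpair_ge 4 (cpair a b)). lia. }
        destruct (IH a k) as (u & Eu & Bu); [lia|exact Ha|].
        destruct (IH b k) as (w & Ew & Bw); [lia|exact Hb|].
        destruct E as [-> | ->]; [exists (Add u w)|exists (Mul u w)]; simpl;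
          rewrite Eu, Ew; auto. }
    assert (HF : forall m t k, t < m -> X (cpair 1 (cpair k t)) ->
              exists p, code p = t /\ below k p).
    { induction m as [|m IH]; intros t k Hlt H; [lia|]. apply HX in H.
      destruct H as [->|[(a & _ & b & _ & E & Ha & Hb)|[(a & _ & b & _ & E & Ha & Hb)|(a & _ & E & Ha)]]].
      - exists Bot. simpl. auto.
      - destruct (HT (S a) a k) as (u & Eu & Bu); [lia|exact Ha|].
        destruct (HT (S b) b k) as (w & Ew & Bw); [lia|exact Hb|].
        destruct E as [-> | ->]; [exists (Eq u w)|exists (Lt u w)]; simpl;
          rewrite Eu, Ew; auto.
      - assert (L : a < t /\ b < t).
        { pose proof (cpair_ge a b). pose proof (cpair_ge 3 (cpair a b)). lia. }
        destruct (IH a k) as (p & Ep & Bp); [lia|exact Ha|].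
        destruct (IH b k) as (q & Eq' & Bq); [lia|exact Hb|].
        exists (Imp p q). simpl. rewrite Ep, Eq'. auto.
      - assert (L : a < t) by (pose proof (cpair_ge 4 a); lia).
        destruct (IH a (S k)) as (p & Ep & Bp); [lia|exact Ha|].
        exists (All p). simpl. rewrite Ep. auto. }
    destruct (HF (S n) n 0) as (p & Ep & Bp); [lia|exact Hn|]. exists p. auto.
  - intros (p & Bp & <-).
    exists (fun i => exists k, (exists u, i = cpair 0 (cpair k (tcode u)) /\ tbelow k u) \/
                           (exists q, i = cpair 1 (cpair k (code q)) /\ below k q)).
    split; [|exists 0; right; exists p; auto].
    intros k t. split; intros (k' & [(u & E & B)|(q & E & B)]);
      apply cpair_inj in E; destruct E as [E0 E]; try discriminate E0; clear E0;
      apply cpair_inj in E; destruct E as [<- ->].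
    + destruct u; simpl in B |- *.
      * left. exists n. auto.
      * right; left; reflexivity.
      * right; right; left; reflexivity.
      * right; right; right. pose proof (cpair_ge (tcode u1) (tcode u2)).
        pose proof (cpair_ge 3 (cpair (tcode u1) (tcode u2))).
        exists (tcode u1); split; [lia|]. exists (tcode u2); split; [lia|]. split; [auto|].
        split; exists k; left; [exists u1|exists u2]; tauto.
      * right; right; right. pose proof (cpair_ge (tcode u1) (tcode u2)).
        pose proof (cpair_ge 4 (cpair (tcode u1) (tcode u2))).
        exists (tcode u1); split; [lia|]. exists (tcode u2); split; [lia|]. split; [auto|].
        split; exists k; left; [exists u1|exists u2]; tauto.
    + destruct q as [u1 u2|u1 u2| |q1 q2|q]; simpl in B |- *.
      * right; left. pose proof (cpair_ge (tcode u1) (tcode u2)).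
        pose proof (cpair_ge 0 (cpair (tcode u1) (tcode u2))).
        exists (tcode u1); split; [lia|]. exists (tcode u2); split; [lia|]. split; [auto|].
        split; exists k; left; [exists u1|exists u2]; tauto.
      * right; left. pose proof (cpair_ge (tcode u1) (tcode u2)).
        pose proof (cpair_ge 1 (cpair (tcode u1) (tcode u2))).
        exists (tcode u1); split; [lia|]. exists (tcode u2); split; [lia|]. split; [auto|].
        split; exists k; left; [exists u1|exists u2]; tauto.
      * left; reflexivity.
      * right; right; left. pose proof (cpair_ge (code q1) (code q2)).
        pose proof (cpair_ge 3 (cpair (code q1) (code q2))).
        exists (code q1); split; [lia|]. exists (code q2); split; [lia|]. split; [auto|].
        split; exists k; right; [exists q1|exists q2]; tauto.
      * right; right; right. pose proof (cpair_ge 4 (code q)).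
        exists (code q); split; [lia|]. split; [auto|].
        exists (S k); right. exists q; tauto.
Qed.

(** * Defining the standard cut, syntax and truth *)

Section Definable.
Variables (A : theory) (std_form : pform).
Hypothesis A_PA : extends_PA A.
Hypothesis Hstd : forall (M : structure) (r : nat -> M), models M A ->
  psat A M r std_form <-> exists n, r 0 = value M n.

Notation Pot := (Pot A).

Lemma Pot_syntax_set : Pot (fun S r => syntax_set S (r 0)).
Proof.
  unfold syntax_set, term_step, form_step. apply Pot_and.
  - apply (Pot_all A std_form Hstd), (Pot_all A std_form Hstd). cbv beta.
    apply Pot_and; apply Pot_imp.
    + refine (Pot_Abs A A_PA (fun O r => O (cpair 0 (cpair (r 1) (r 0))) 0 0 0) _). abs.
    + refine (Pot_Abs A A_PA (fun O r => term_step (fun i => O i 0 0 0) (r 1) (r 0)) _).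
      unfold term_step. abs.
    + refine (Pot_Abs A A_PA (fun O r => O (cpair 1 (cpair (r 1) (r 0))) 0 0 0) _). abs.
    + refine (Pot_Abs A A_PA (fun O r => form_step (fun i => O i 0 0 0) (r 1) (r 0)) _).
      unfold form_step. abs.
  - refine (Pot_Abs A A_PA (fun O r => O (cpair 1 (cpair 0 (r 0))) 0 0 0) _). abs.
Qed.

Lemma Fn_fadd w f g h : Fn w f -> Fn w g -> Fn w h -> Fn w (fun r => fadd (f r) (g r) (h r)).
Proof. intros. apply Fn_cpair; [apply Fn_const|]. apply Fn_env3; apply Fn_cst; assumption. Qed.

Lemma Fn_fmul w f g h : Fn w f -> Fn w g -> Fn w h -> Fn w (fun r => fmul (f r) (g r) (h r)).
Proof. intros. apply Fn_cpair; [apply Fn_const|]. apply Fn_env3; apply Fn_cst; assumption. Qed.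

Lemma Pot_truth_set : Pot (fun S r => truth_set S (r 0)).
Proof.
  unfold truth_set. apply Pot_and; [|apply Pot_and; [|apply Pot_and]].
  - do 4 apply (Pot_all A std_form Hstd). cbv beta. apply Pot_not.
    eapply Pot_iff; [|refine (Pot_Abs A A_PA (fun O r => violates (fun i => O i 0 0 0) (fun i => ~ O i 0 0 0)
      (fun k => r match k with 0 => 3 | 1 => 2 | 2 => 1 | _ => 0 end) henkin_clauses) _)].
    + intros S r. cbv beta.
      replace (scons (r 3) (scons (r 2) (scons (r 1) (fun _ => r 0)))) with
        (fun k => r match k with 0 => 3 | 1 => 2 | 2 => 1 | _ => 0 end); [reflexivity|].
      apply functional_extensionality. intros [|[|[|k]]]; reflexivity.
    + apply (Abs_violates bit_form (fun O r i => O i 0 0 0) (fun O r i => ~ O i 0 0 0)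
        (fun k => match k with 0 => 3 | 1 => 2 | 2 => 1 | _ => 0 end)).
      * intros f Hf. apply Abs_oracle; fn; assumption.
      * intros f Hf. apply Abs_not, Abs_oracle; fn; assumption.
      * apply Fn_henkin_clauses.
  - do 2 apply (Pot_all A std_form Hstd). cbv beta.
    refine (Pot_Abs A A_PA (fun O r => true_diagram (fun i => O i 0 0 0) (r 1) (r 0)) _).
    unfold true_diagram.
    assert (H0 : Fn bit_form (fun r => r 0)) by fn.
    assert (H1 : Fn bit_form (fun r => r 1)) by fn.
    assert (HO : forall f, Fn bit_form f -> Abs bit_form (fun O r => O (f r) 0 0 0))
      by (intros; apply Abs_oracle; fn; assumption).
    assert (HE : Fn bit_form (fun r => eqn (cst (r 1)) (cst (r 0))))
      by (apply Fn_eqn; apply Fn_cst; assumption).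
    assert (HL : Fn bit_form (fun r => ltn (cst (r 1)) (cst (r 0))))
      by (apply Fn_ltn; apply Fn_cst; assumption).
    repeat apply Abs_and.
    + apply (HO (fun r => fadd (r 1) (r 0) (r 1 + r 0))), Fn_fadd; fn.
    + apply (HO (fun r => fmul (r 1) (r 0) (r 1 * r 0))), Fn_fmul; fn.
    + apply Abs_imp; [abs|apply (HO _ HE)].
    + apply Abs_imp; [apply (HO _ HE)|abs].
    + apply Abs_imp; [abs|apply (HO _ HL)].
    + apply Abs_imp; [apply (HO _ HL)|abs].
    + apply (HO (fun r => _)), Fn_const.
    + apply (HO (fun r => _)), Fn_const.
  - apply (Pot_all A std_form Hstd), (Pot_ex A std_form Hstd). cbv beta.
    refine (Pot_Abs A A_PA (fun O r => O (eqn (r 1) (cst (r 0))) 0 0 0) _).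
    apply Abs_oracle; fn.
  - refine (Pot_Abs A A_PA (fun O r => O (cpair (r 0) 0) 0 0 0) _). abs.
Qed.

End Definable.

Lemma standard_definable (A : theory) :
  (forall p : form, A p -> sentence p) -> ce_theory A -> extends_PA A ->
  exists q : pform, forall (M : structure) (r : nat -> M), models M A ->
    psat A M r q <-> exists n, r 0 = value M n.
Proof.
  intros HS Hce HPA.
  destruct (Sig_codes fact_form A Hce) as (R & HRA & HR).
  destruct (Abs_stage fact_form R HRA) as [p Hp].
  set (D := nonstd_form p).
  (* [D] depends only on its first two variables, so the numeral of its code may replace all
     variables but the first. *)
  exists (MBox (pform_of (Neg (subst (scons (Var 0) (fun _ => num (code D))) D)))).
  intros M r HM. cbn [psat].
  assert (E : forall (N : structure) (s : nat -> N),
     psat A N s (pform_of (Neg (subst (scons (Var 0) (fun _ => num (code D))) D))) <->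
     ~ sat N (scons (s 0) (scons (value N (code D)) s)) D).
  { intros N s. rewrite psat_pform_of, sat_Neg, sat_subst.
    apply not_iff_compat, (nonstd_form_ext p N); [reflexivity|apply teval_num]. }
  split.
  - intros H. apply NNPP. intros Hn.
    destruct (nonstandard_D A R p HS HPA HR Hp M (r 0) HM) as (N & e & HN & He & HD); [eauto|].
    specialize (H N e HN He). rewrite E in H. apply H. apply HD.
  - intros [n Hn] N e HN He. rewrite E. cbv beta. rewrite Hn, (embedding_value M N e n He).
    apply (standard_not_D A R p HPA HR Hp N n _ HN).
Qed.

Theorem theorem9 (A : theory)
    (A_sentences : forall p : form, A p -> sentence p)
    (A_consistent : consistent A)
    (A_ce : ce_theory A)
    (A_PA : extends_PA A) :
  exists T : pform,
    pbelow 1 T /\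
    forall (M : structure) (x : M),
      models M A ->
      (psat A M (fun _ => x) T <->
       exists n : nat, x = value M n /\ true_sentence_code n).
Proof.
  destruct (standard_definable A A_sentences A_ce A_PA) as [q Hq].
  destruct (Pot_set A A_PA _ (Pot_syntax_set A q A_PA Hq)) as [s Hs].
  destruct (Pot_set A A_PA _ (Pot_truth_set A q A_PA Hq)) as [t Ht].
  (* Sending all variables to 0 leaves [x] as the only parameter and makes the environment constant,
     which fits [s] and [t] once [q] has forced [x] to be standard. *)
  exists (pren (fun _ => 0) (mAnd q (mAnd s t))). split; [apply pbelow_pren; auto|].
  intros M x HM. rewrite psat_pren, !psat_mAnd, Hq by exact HM.
  assert (E : forall n, x = value M n ->
    (psat A M (fun _ => x) s /\ psat A M (fun _ => x) t <-> true_sentence_code n)).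
  { intros n ->. rewrite (Hs M (fun _ => n) HM), (Ht M (fun _ => n) HM), syntax_set_spec.
    split.
    - intros [(p & Hp & <-) H]. exists p. split; [exact Hp|split; [|reflexivity]].
      apply truth_set_spec; assumption.
    - intros (p & Hp & Hr & <-). split; [eauto|]. apply truth_set_spec; assumption. }
  split.
  - intros [[n Hn] H]. exists n. split; [exact Hn|]. apply (E n Hn), H.
  - intros (n & Hn & H). split; [eauto|]. apply (E n Hn), H.
Qed.
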